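(* Let $M>0$ be a fixed number and let $\mu$ be a (complex) Radon measure on the real line such that $|\mu|([\alpha,\beta])\le M$ whenever $\beta-\alpha\le1$. Let the Borel function $K(t)$ belong to $L_1(-\infty,\infty)$ and let $\widehat K(\lambda)=\int_{-\infty}^\infty K(t)e^{-i\lambda t}dt\ne0$ for $\lambda\in(a,b)$. Suppose that $$\int_{-\infty}^\infty K(t-u)\,d\mu(t)=0,\qquad u\in(-\infty,\infty),$$ and let $G(z)=(G_+(z),G_-(z))$ be the Carleman transform of $\mu$. Then: 1) $|G(z)|\le M\left(1+\frac1{|y|}\right)$, $z=x+iy$, $y\neq 0$; 2) the function $G_+(z)$ admits analytic continuation across the interval $(a,b)$, and the result of the analytic continuation is the function $G_-(z)$.
   Context: The Carleman transform of a Radon measure $\mu$ on $\mathbb R$ satisfying $|\mu|([-t,t])\le M_1(1+t^\alpha)$ for some $M_1$ and $\alpha\ge0$ is the pair $G(z)=(G_+(z),G_-(z))$, where $$G_+(z)=\int_0^{\infty\,\prime}e^{itz}d\mu(t),\quad \operatorname{Im}z>0,\qquad G_-(z)=-\int_{-\infty}^{0\,\prime}e^{itz}d\mu(t),\quad \operatorname{Im}z<0.$$ The prime means that the integration over $[0,\infty)$, respectively $(-\infty,0]$, is with respect to the measure $\mu-\frac12\mu(\{0\})\delta$, where $\delta$ is the unit mass at $0$. $G(z)$ denotes $G_+(z)$ for $\operatorname{Im}z>0$ and $G_-(z)$ for $\operatorname{Im}z<0$. Here $|\mu|$ is the total variation of $\mu$. *)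

(* Defs.v *)
From mathcomp Require Import all_boot all_order all_algebra.
From mathcomp Require Import all_classical all_reals all_analysis.
From mathcomp Require Import complex.

Set Implicit Arguments.
Unset Strict Implicit.
Unset Printing Implicit Defensive.

Import Order.TTheory GRing.Theory Num.Theory.
Import numFieldNormedType.Exports.

Local Open Scope classical_set_scope.
Local Open Scope ring_scope.
Local Open Scope complex_scope.

(* [complex.Re], [complex.Im] : R[i] -> R are the projections of [R[i]], and
   [Normc.normc] : R[i] -> R is the modulus; the library's [`|z|] has type
   R[i]. *)

Definition cexp (R : realType) (z : R[i]) : R[i] :=
  (expR (complex.Re z) * cos (complex.Im z)) +i*
  (expR (complex.Re z) * sin (complex.Im z)).

Section RadonMeasure.
Variable R : realType.

Definition bounded_borel (A : set R) : Prop := measurable A /\ bounded_set A.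

(* A complex Radon measure on the line need not have finite total mass, so it
   is a set function on the bounded Borel sets, countably additive within
   them; finiteness on each bounded interval, hence regularity, is then
   automatic.  The values of [mu] at other sets are never used.  Taking every
   [F n] empty gives [mu set0 = 0]. *)
Definition complex_radon_measure (mu : set R -> R[i]) : Prop :=
  forall F : nat -> set R,
    (forall n, bounded_borel (F n)) -> trivIset [set: nat] F ->
    bounded_borel (\bigcup_n F n) ->
    series (fun n => mu (F n) : R[i]^o) @ \oo --> (mu (\bigcup_n F n) : R[i]^o).

(* |mu|(A).  For A bounded the finite disjoint families inside A can be
   completed to partitions of A; for A unbounded this is the supremum of
   |mu|(B) over the bounded Borel subsets B of A. *)
Definition radon_variation (mu : set R -> R[i]) (A : set R) : \bar R :=
  ereal_sup [set x : \bar R | exists n (F : nat -> set R),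
    [/\ forall i, bounded_borel (F i), trivIset [set: nat] F,
        forall i, F i `<=` A
      & x = (\sum_(i < n) Normc.normc (mu (F i)))%:E]].

(* The positive and the negative part in the Jordan decomposition of a real
   Radon measure. *)
Definition upper_variation (nu : set R -> R) (A : set R) : \bar R :=
  ereal_sup [set (nu B)%:E | B in [set B | bounded_borel B /\ B `<=` A]].

Definition lower_variation (nu : set R -> R) (A : set R) : \bar R :=
  upper_variation (fun B => - nu B) A.

(* Both components being measurable amounts to [f] being Borel. *)
Definition cintegrable (nu : set R -> \bar R) (D : set R) (f : R -> R[i]) :
    Prop :=
  nu.-integrable D (fun t => (complex.Re (f t))%:E) /\
  nu.-integrable D (fun t => (complex.Im (f t))%:E).

Definition cintegral (nu : set R -> \bar R) (D : set R) (f : R -> R[i]) :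
    R[i] :=
  fine (\int[nu]_(t in D) (complex.Re (f t))%:E) +i*
  fine (\int[nu]_(t in D) (complex.Im (f t))%:E).

(* The integral of [f] against [mu], for [f] integrable against |mu|, which
   dominates the four positive measures used here. *)
Definition radon_integral (mu : set R -> R[i]) (D : set R) (f : R -> R[i]) :
    R[i] :=
  let re A := complex.Re (mu A) in
  let im A := complex.Im (mu A) in
  (cintegral (upper_variation re) D f - cintegral (lower_variation re) D f) +
  'i * (cintegral (upper_variation im) D f -
        cintegral (lower_variation im) D f).

Definition fourier (K : R -> R[i]) (lambda : R) : R[i] :=
  cintegral lebesgue_measure [set: R]
    (fun t => K t * cexp (- ('i * lambda%:C * t%:C))).

(* mu - (1/2) mu({0}) delta_0 *)
Definition halve_at0 (mu : set R -> R[i]) (A : set R) : R[i] :=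
  mu A - 2^-1 * mu [set 0] * (\1_A (0 : R))%:C.

Definition carleman_plus (mu : set R -> R[i]) (z : R[i]) : R[i] :=
  radon_integral (halve_at0 mu) `[0, +oo[ (fun t => cexp ('i * t%:C * z)).

Definition carleman_minus (mu : set R -> R[i]) (z : R[i]) : R[i] :=
  - radon_integral (halve_at0 mu) `]-oo, 0] (fun t => cexp ('i * t%:C * z)).

(* Meaningful for [complex.Im z != 0] only. *)
Definition carleman (mu : set R -> R[i]) (z : R[i]) : R[i] :=
  if 0 < complex.Im z then carleman_plus mu z else carleman_minus mu z.

Definition upper_half_plane : set R[i] := [set z | 0 < complex.Im z].
Definition lower_half_plane : set R[i] := [set z | complex.Im z < 0].

(* The plane slit along the two real half-lines outside (a, b); it is an open
   connected set when a < b. *)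
Definition slit_plane (a b : \bar R) : set R[i] :=
  upper_half_plane `|` lower_half_plane `|`
  [set x%:C | x in [set x : R | (a < x%:E < b)%E]].

(* To be used on open sets: complex differentiability at every point. *)
Definition holomorphic_on (D : set R[i]) (F : R[i] -> R[i]) : Prop :=
  forall z, D z -> derivable (F : R[i]^o -> R[i]^o) z 1.

(* [f] continues analytically from the upper half-plane across (a, b), and the
   continuation coincides with [g] in the lower half-plane. *)
Definition continues_across (a b : \bar R) (f g : R[i] -> R[i]) : Prop :=
  exists F : R[i] -> R[i],
    [/\ holomorphic_on (slit_plane a b) F,
        {in upper_half_plane, F =1 f}
      & {in lower_half_plane, F =1 g}].

End RadonMeasure.

(* Main.v *)
From HB Require Import structures.
Require Import Defs.
From mathcomp Require Import all_boot all_order all_algebra.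
From mathcomp Require Import all_classical all_reals all_analysis.
From mathcomp Require Import measurable_realfun complex ring lra.
Import Order.TTheory GRing.Theory Num.Theory.
Import numFieldNormedType.Exports.
Local Open Scope classical_set_scope.
Local Open Scope ring_scope.
Set Implicit Arguments.
Unset Strict Implicit.
Unset Printing Implicit Defensive.
Local Open Scope complex_scope.

(** The growth estimate. Cut the half-line into unit intervals. On the piece at
    distance l from 0 the exponential has modulus at most e^(-l|y|), and the
    variation of mu is at most M, so the transform is bounded by
    M / (1 - e^(-|y|)), which is at most M (1 + 1 / |y|) because
    e^|y| >= 1 + |y|. Halving the atom at 0 does not increase the variation, as it
    averages mu with its restriction to the complement of 0
    ([halve_at0_variation]). The estimate is [half_line_bound].

    The continuation. For nonreal z let e_z be the kernel e^(ixz) h(x) above the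
    real line and e^(ixz) (h(x) - 1) below it, where h is the Heaviside function
    with h(0) = 1/2, and let f_z(s) be the integral of e_z(t - s) against mu. Then
    f_z(0) is the Carleman transform in both half-planes ([carleman_plusE],
    [carleman_minusE]). Three facts are used.

    - Exchanging integrations, K is orthogonal to all translates of f_z, and of
      every other correlation of mu with an exponentially decaying kernel
      ([correlation_orthogonal]).

    - The twisted increment e^(iuz) f_z(s + u) - f_z(s) is an integral against mu
      over the interval between s and s + u, of a kernel that is entire in z and is
      the same in both half-planes ([ckernel_increment]). It stays bounded when z
      approaches the real line.

    - Near a point l of (a, b) a correlation f is bounded by its twisted increments
      ([contracting_fourier]). If these are small then f(s + t) is close to
      e^(-itl) f(s) on a long interval of t, and integrating against K shows that
      the Fourier transform of K at l times f(s) is small. Near nonreal points the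
      same property is immediate ([contracting_nonreal]).

    Hence f_z is bounded uniformly for nonreal z near l. The same argument applies
    to the derivative of the kernel in z and to its first-order Taylor remainder,
    whose twisted increments are expressed through the bounds already obtained. It
    yields a Taylor estimate G(z) - G(w) - (z - w) G_1(w) = O(|z - w|^2) for nonreal
    z and w near l, possibly on different sides of the real line
    ([correlation_taylor]). Such an estimate lets G and G_1 extend by Lipschitz
    continuity to real points, and the extension of G is differentiable there with
    derivative the extension of G_1 ([taylor_extension]). No contour integrals are
    involved, and no local inverse of the Fourier transform of K: the contraction
    property plays its role. *)

Local Notation normc := Normc.normc.

(** * Bounded Borel sets and the upper variation of a real Radon measure *)

Lemma bounded_setP {R : realType} (A : set R) :
  bounded_set A <-> exists n : nat, A `<=` `[- n%:R, n%:R].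
Proof.
split=> [[M [_ HM]]|[n HA]].
  exists (Num.bound `|M + 1|) => x Ax /=.
  have HMx : `|x| <= M + 1 by apply: (HM (M + 1)) => //; rewrite ltrDl.
  have := archi_boundP (normr_ge0 (M + 1)); have := ler_norm (M + 1).
  move=> h1 h2; rewrite in_itv /= -ler_norml; lra.
exists n%:R; split; first exact: num_real.
move=> y /ltW ny x /HA /=; rewrite in_itv /= => xn.
by rewrite (le_trans _ ny)// ler_norml.
Qed.

Lemma bounded_borel_sub {R : realType} (A B : set R) :
  measurable A -> A `<=` B -> bounded_borel B -> bounded_borel A.
Proof.
move=> mA AB [_ /bounded_setP[n Bn]]; split=> //.
by apply/bounded_setP; exists n; exact: subset_trans Bn.
Qed.

Lemma bounded_borel0 {R : realType} : bounded_borel (set0 : set R).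
Proof. by split=> //; apply/bounded_setP; exists 0%N. Qed.

Lemma bounded_borel_itv {R : realType} (a b : R) : bounded_borel `[a, b].
Proof.
split=> //; apply/bounded_setP; exists (Num.bound (`|a| + `|b|)) => x /=.
have H := archi_boundP (addr_ge0 (normr_ge0 a) (normr_ge0 b)).
rewrite !in_itv /= => /andP[ax xb]; apply/andP; split.
  have := ler_norm (- a); have := normr_ge0 b; rewrite normrN; lra.
have := ler_norm b; have := normr_ge0 a; lra.
Qed.

Lemma bounded_borelU {R : realType} (A B : set R) :
  bounded_borel A -> bounded_borel B -> bounded_borel (A `|` B).
Proof.
move=> [mA /bounded_setP[n An]] [mB /bounded_setP[m Bm]]; split.
  exact: measurableU.
apply/bounded_setP; exists (n + m)%N => x [/An|/Bm] /=; rewrite !in_itv /= -!ler_norml => h.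
  by rewrite (le_trans h)// ler_nat leq_addr.
by rewrite (le_trans h)// ler_nat leq_addl.
Qed.

Lemma bounded_borel_bigsetU {R : realType} (F : nat -> set R) n :
  (forall i, bounded_borel (F i)) -> bounded_borel (\big[setU/set0]_(i < n) F i).
Proof.
move=> bF; elim: n => [|n IH]; first by rewrite big_ord0; exact: bounded_borel0.
by rewrite big_ord_recr /=; exact: bounded_borelU.
Qed.

(** The real counterpart of complex Radon measures, satisfied by the components of
    a complex one. *)
Definition real_radon {R : realType} (nu : set R -> R) : Prop :=
  forall F : nat -> set R,
    (forall n, bounded_borel (F n)) -> trivIset [set: nat] F ->
    bounded_borel (\bigcup_n F n) ->
    series (fun n => nu (F n)) @ \oo --> nu (\bigcup_n F n).

Section radon.
Context {R : realType} {nu : set R -> R}.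
Hypothesis hnu : real_radon nu.

Lemma real_radon0 : nu set0 = 0.
Proof.
have /cvgP/cvg_series_cvg_0 : series (fun n : nat => nu set0) @ \oo --> nu (\bigcup_(n : nat) set0).
  apply: hnu => [n||]; [exact: bounded_borel0| |rewrite bigcup0//; exact: bounded_borel0].
  by apply/trivIsetP => *; rewrite setI0.
by move/(cvg_lim (@norm_hausdorff _ _)); rewrite lim_cst.
Qed.

Lemma real_radonU_big F n : (forall i, bounded_borel (F i)) ->
  trivIset [set: nat] F -> nu (\big[setU/set0]_(i < n) F i) = \sum_(i < n) nu (F i).
Proof.
move=> bF tF.
pose G i := if (i < n)%N then F i else set0.
have GE : \bigcup_i G i = \big[setU/set0]_(i < n) F i.
  rewrite -(bigcup_mkord n F); apply/seteqP; split=> x.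
    by move=> [i _]; rewrite /G; case: ifP => // ni Fx; exists i.
  by move=> [i /= ni Fx]; exists i => //; rewrite /G ni.
have := @hnu G; rewrite GE => /(_ _ _ _)/cvg_lim <-//.
- apply/cvg_lim => //; apply: cvg_near_cst.
  near=> m; have nm : (n <= m)%N by near: m; exists n.
  rewrite /series /= (@big_cat_nat _ _ _ n)//=.
  have -> : \sum_(n <= i < m) nu (G i) = 0.
    rewrite big_nat_cond big1// => i /andP[/andP[ni _] _].
    by rewrite /G ltnNge ni real_radon0.
  by rewrite addr0 big_mkord; apply: eq_bigr => i _; rewrite /G ltn_ord.
- by move=> i; rewrite /G; case: ifP => // _; exact: bounded_borel0.
- apply/trivIsetP => i j _ _ ij; rewrite /G; case: ifP => _; last by rewrite set0I.
  case: ifP => _; last by rewrite setI0.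
  by move/trivIsetP : tF; exact.
- exact: bounded_borel_bigsetU.
Unshelve. all: by end_near. Qed.

Lemma real_radonU A B : bounded_borel A -> bounded_borel B -> A `&` B = set0 ->
  nu (A `|` B) = nu A + nu B.
Proof.
move=> bA bB AB; rewrite -bigcup2E.
have := @real_radonU_big (bigcup2 A B) 2%N; rewrite !big_ord_recl !big_ord0 /= /bump /= addr0 setU0.
rewrite bigcup2E; apply.
- by move=> [|[|i]] //=; exact: bounded_borel0.
- apply/trivIsetP => -[|[|i]] [|[|j]] //= _ _ _; rewrite ?set0I ?setI0//.
  by rewrite setIC.
Qed.

Lemma real_radonD A B : bounded_borel A -> bounded_borel B -> B `<=` A ->
  nu A = nu B + nu (A `\` B).
Proof.
move=> bA bB BA; have bAB : bounded_borel (A `\` B).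
  apply: (bounded_borel_sub _ _ bA); last exact: subDsetl.
  by apply: measurableD; [exact: bA.1|exact: bB.1].
rewrite -[in LHS](setDUK BA) real_radonU// ?setDIK//.
Qed.

Lemma le_upper_variation A B : A `<=` B -> (upper_variation nu A <= upper_variation nu B)%E.
Proof.
move=> AB; apply: le_ereal_sup => _ [C [bC CA] <-]; exists C => //.
by split=> //; exact: subset_trans AB.
Qed.

Lemma upper_variation_ub A B : bounded_borel B -> B `<=` A ->
  ((nu B)%:E <= upper_variation nu A)%E.
Proof. by move=> bB BA; apply: ereal_sup_ubound; exists B. Qed.

Lemma upper_variation0 : upper_variation nu set0 = 0%E.
Proof.
apply/eqP; rewrite eq_le; apply/andP; split.
  by apply: ge_ereal_sup => _ [B [_ B0] <-]; rewrite (_ : B = set0) ?real_radon0// -subset0.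
by rewrite -[0%E]/(0%:E) -real_radon0 upper_variation_ub//; exact: bounded_borel0.
Qed.

Lemma upper_variation_ge0 A : (0 <= upper_variation nu A)%E.
Proof.
rewrite -[0%E]/(0%:E) -real_radon0 upper_variation_ub//; exact: bounded_borel0.
Qed.

(** Test sets inside A and inside B unite to a test set inside their union; the
    case of an infinite variation follows from monotonicity. *)
Lemma upper_variationU_ge A B : A `&` B = set0 ->
  (upper_variation nu A + upper_variation nu B <= upper_variation nu (A `|` B))%E.
Proof.
move=> AB0.
have key B1 B2 : bounded_borel B1 -> B1 `<=` A -> bounded_borel B2 -> B2 `<=` B ->
    ((nu B1)%:E + (nu B2)%:E <= upper_variation nu (A `|` B))%E.
  move=> bB1 B1A bB2 B2B; rewrite -EFinD -real_radonU//.
    by apply: upper_variation_ub; [exact: bounded_borelU|exact: setUSS].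
  by rewrite -subset0 -AB0; exact: setISS.
have := upper_variation_ge0 B; have := @le_upper_variation B (A `|` B) (@subsetUr _ _ _).
case uB : (upper_variation nu B) => [r| |]//; last first.
  rewrite leye_eq => /eqP -> _; exact: leey.
move=> _ _; rewrite -leeBrDr//; apply: ge_ereal_sup => _ [B1 [bB1 B1A] <-].
rewrite leeBrDr// addeC -leeBrDr// -uB; apply: ge_ereal_sup => _ [B2 [bB2 B2B] <-].
by rewrite leeBrDr// addeC; exact: key.
Qed.

Lemma upper_variation_sum_le F n : trivIset [set: nat] F ->
  (\sum_(i < n) upper_variation nu (F i) <= upper_variation nu (\bigcup_i F i))%E.
Proof.
move=> tF; apply: (@le_trans _ _ (upper_variation nu (\big[setU/set0]_(i < n) F i))).
  elim: n => [|n IH]; first by rewrite !big_ord0 upper_variation0.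
  rewrite !big_ord_recr /=; apply: le_trans (leeD IH (lexx _)) _.
  apply: upper_variationU_ge.
  rewrite -bigcup_mkord -subset0 => x [[i /= ni Fix] Fnx].
  by have := tF i n I I (ex_intro _ x (conj Fix Fnx)) => /eqP; rewrite ltn_eqF.
by apply: le_upper_variation; rewrite -bigcup_mkord; apply: bigcup_sub => i _; exact: bigcup_sup.
Qed.

(** A bounded test set B is cut into the pieces of B inside the F i, and countable
    additivity of nu on bounded sets bounds nu B by the sum of the variations; the
    other inequality is finite superadditivity. *)
Lemma upper_variation_sigma_additive : semi_sigma_additive (upper_variation nu).
Proof.
move=> F mF tF _.
have u0 i : (0 <= upper_variation nu (F i))%E by exact: upper_variation_ge0.
have -> : upper_variation nu (\bigcup_i F i) = (\sum_(0 <= i <oo) upper_variation nu (F i))%E.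
  apply/eqP; rewrite eq_le; apply/andP; split; last first.
    apply: lime_le; first by apply: is_cvg_nneseries => i _ _.
    by near=> n; rewrite big_mkord; exact: upper_variation_sum_le.
  apply: ge_ereal_sup => _ [B [bB BF] <-].
  have bBF i : bounded_borel (B `&` F i).
    by apply: (bounded_borel_sub _ _ bB); [apply: measurableI => //; exact: bB.1|exact: subIsetl].
  have BE : B = \bigcup_i (B `&` F i) by rewrite -setI_bigcupr; apply/esym/setIidl.
  have cv : series (fun n => nu (B `&` F n)) @ \oo --> nu B.
    rewrite [X in _ --> nu X]BE; apply: hnu => //; last by rewrite -BE.
    by apply: trivIset_setIl.
  have /cvg_lim <-// : (fun n => (series (fun n => nu (B `&` F n)) n)%:E) @ \oo --> (nu B)%:E.
    by apply: cvg_EFin => //; exact: nearW.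
  apply: lee_lim.
  - by apply/cvg_ex; exists (nu B)%:E; apply: cvg_EFin => //; exact: nearW.
  - by apply: is_cvg_nneseries => i _ _.
  near=> n; rewrite /series /= -sumEFin; apply: lee_sum => i _.
  by apply: upper_variation_ub => //; exact: subIsetr.
by apply: is_cvg_nneseries => i _ _.
Unshelve. all: by end_near. Qed.

(** Packages the upper variation as a measure, so that the integrals against it
    in the definition of radon_integral obey the usual theory. *)
Lemma upper_variation_measure :
  (forall x : R, (upper_variation nu `[x, (x + 1)%R] < +oo)%E) ->
  exists p : {sigma_finite_measure set R -> \bar R},
    upper_variation nu = p :> (set R -> \bar R).
Proof.
move=> fin.
pose m := isMeasure.Build _ _ _ (upper_variation nu) upper_variation0 upper_variation_ge0
  upper_variation_sigma_additive.
pose p : {measure set R -> \bar R} := HB.pack (upper_variation nu) m.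
have sf : sigma_finite setT p.
  (* the countably many unit intervals with integer end points *)
  pose l (n : nat) : R := (odflt 0 (unpickle n : option int))%:~R.
  exists (fun n => `[l n, (l n + 1)%R]%classic); last by move=> n; split => //; exact: fin.
  apply/esym; rewrite -subTset => x _; exists (pickle (Num.floor x)) => //=.
  by rewrite /l pickleK /= in_itv /= ge_floor -intrD1 ltW// floorD1_gt.
pose s : {sigma_finite_measure set R -> \bar R} :=
  HB.pack (p : set R -> \bar R) p (Measure_isSigmaFinite.Build _ _ _ p sf).
by exists s.
Qed.

End radon.

(** * Modulus and components of complex numbers and measures *)

Section cplx.
Context {R : realType}.
Implicit Types z w : R[i].

Lemma ReD z w : complex.Re (z + w) = complex.Re z + complex.Re w.
Proof. by case: z; case: w. Qed.
Lemma ImD z w : complex.Im (z + w) = complex.Im z + complex.Im w.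
Proof. by case: z; case: w. Qed.
Lemma ReN z : complex.Re (- z) = - complex.Re z. Proof. by case: z. Qed.
Lemma ImN z : complex.Im (- z) = - complex.Im z. Proof. by case: z. Qed.
Lemma ReM z w : complex.Re (z * w) =
  complex.Re z * complex.Re w - complex.Im z * complex.Im w.
Proof. by case: z; case: w. Qed.
Lemma ImM z w : complex.Im (z * w) =
  complex.Re z * complex.Im w + complex.Im z * complex.Re w.
Proof. by case: z => a b; case: w. Qed.
Lemma Re_sum I (r : seq I) P (F : I -> R[i]) :
  complex.Re (\sum_(i <- r | P i) F i) = \sum_(i <- r | P i) complex.Re (F i).
Proof. by apply: (big_morph _ ReD). Qed.
Lemma Im_sum I (r : seq I) P (F : I -> R[i]) :
  complex.Im (\sum_(i <- r | P i) F i) = \sum_(i <- r | P i) complex.Im (F i).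
Proof. by apply: (big_morph _ ImD). Qed.

Lemma normcE z : normc z = Num.sqrt (complex.Re z ^+ 2 + complex.Im z ^+ 2).
Proof. by case: z. Qed.
Lemma normc_ge0 z : 0 <= normc z. Proof. by rewrite normcE sqrtr_ge0. Qed.
Lemma normr_normc z : `|z| = (normc z)%:C. Proof. by rewrite normc_def normcE. Qed.

Lemma normc_Re z : `|complex.Re z| <= normc z.
Proof. by rewrite normcE -sqrtr_sqr ler_wsqrtr// lerDl sqr_ge0. Qed.
Lemma normc_Im z : `|complex.Im z| <= normc z.
Proof. by rewrite normcE -sqrtr_sqr ler_wsqrtr// lerDr sqr_ge0. Qed.
Lemma normc_le z : normc z <= `|complex.Re z| + `|complex.Im z|.
Proof.
have h : 0 <= `|complex.Re z| + `|complex.Im z| by rewrite addr_ge0.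
rewrite normcE -[leRHS]ger0_norm// -[leRHS]sqrtr_sqr ler_wsqrtr//.
rewrite -(real_normK (num_real (complex.Re z))) -(real_normK (num_real (complex.Im z))).
have := normr_ge0 (complex.Re z); have := normr_ge0 (complex.Im z); nra.
Qed.

Lemma ler_normcD z w : normc (z + w) <= normc z + normc w.
Proof. exact: le_normcD. Qed.
Lemma ler_normcB z w : normc (z - w) <= normc z + normc w.
Proof. by rewrite -[normc w]normcN ler_normcD. Qed.
Lemma ler_normc_sum I (r : seq I) P (F : I -> R[i]) :
  normc (\sum_(i <- r | P i) F i) <= \sum_(i <- r | P i) normc (F i).
Proof.
elim/big_rec2: _ => [|i y x _ IH]; first by rewrite Normc.normc0.
by rewrite (le_trans (ler_normcD _ _))// lerD2l.
Qed.
Lemma normcR (x : R) : normc x%:C = `|x|.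
Proof. by rewrite normcE /= expr0n addr0 sqrtr_sqr. Qed.
Lemma normcX z n : normc (z ^+ n) = normc z ^+ n.
Proof. by elim: n => [|n IH]; rewrite ?expr0 ?Normc.normc1// !exprS Normc.normcM IH. Qed.
Lemma normc_i : normc ('i : R[i]) = 1.
Proof. by rewrite normcE /= expr0n add0r sqrtr_sqr normr1. Qed.
Lemma normcB z w : normc (z - w) = normc (w - z).
Proof. by rewrite -normcN opprB. Qed.
End cplx.

Section part.
Context {R : realType}.
Implicit Types (mu : set R -> R[i]) (A B : set R).

(** The real part of (-i)^k mu. Letting k run through 0, 1, 2, 3 gives the real and
    imaginary components together with their opposites, which puts the four
    positive measures of radon_integral on the same footing. *)
Definition part (mu : set R -> R[i]) (k : nat) (A : set R) : R :=
  complex.Re ((- 'i) ^+ k * mu A).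

Lemma radon_integral_part mu D f : radon_integral mu D f =
  \sum_(k < 4) 'i ^+ k * cintegral (upper_variation (part mu k)) D f.
Proof.
rewrite /radon_integral /lower_variation !big_ord_recl big_ord0 /bump /=.
have part0 : (fun A => complex.Re (mu A)) = part mu 0.
  by apply/funext => A; rewrite /part expr0 mul1r.
have part1 : (fun A => complex.Im (mu A)) = part mu 1.
  apply/funext => A; rewrite /part expr1 ReM /=; lra.
have part2 : (fun A => - complex.Re (mu A)) = part mu 2.
  apply/funext => A; rewrite /part sqrrN sqr_i mulN1r ReN//.
have part3 : (fun A => - complex.Im (mu A)) = part mu 3.
  apply/funext => A; rewrite /part exprS sqrrN sqr_i ReM /=; lra.
rewrite part0 part1 part2 part3 expr0 mul1r expr1 sqr_i exprS sqr_i addr0.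
by set a := cintegral _ _ _; set b := cintegral _ _ _; set c := cintegral _ _ _;
 set d := cintegral _ _ _; ring.
Qed.

Lemma part_sum mu A :
  mu A = \sum_(k < 2) 'i ^+ k * (part mu k A)%:C.
Proof.
rewrite !big_ord_recl big_ord0 /= /bump /= expr0 mul1r addr0 expr1 /part expr0 expr1 mul1r.
by case: (mu A) => a b; simpc.
Qed.

Lemma part_radon mu k : complex_radon_measure mu -> real_radon (part mu k).
Proof.
move=> hmu F bF tF bU; have /cvgrPdist_lt H := hmu F bF tF bU.
apply/cvgrPdist_lt => e e0.
have e0' : 0 < e%:C :> R[i] by rewrite ltcR.
near=> n.
have : `|(mu (\bigcup_n F n) : R[i]^o) - series (fun n => mu (F n) : R[i]^o) n| < e%:C.
  by near: n; exact: H.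
rewrite normr_normc ltcR; apply: le_lt_trans.
have -> : part mu k (\bigcup_n F n) - series (fun n => part mu k (F n)) n =
  complex.Re ((- 'i) ^+ k * (mu (\bigcup_n F n) - \sum_(0 <= i < n) mu (F i)) : R[i]).
  by rewrite mulrBr ReD ReN /series /= mulr_sumr Re_sum.
apply: le_trans (normc_Re _) _.
by rewrite Normc.normcM normcX normcN normc_i expr1n mul1r.
Unshelve. all: by end_near. Qed.

Lemma normc_le_variation mu A B : mu set0 = 0 -> bounded_borel B -> B `<=` A ->
  ((normc (mu B))%:E <= radon_variation mu A)%E.
Proof.
move=> mu0 bB BA; apply: ereal_sup_ubound.
exists 1%N, (bigcup2 B set0); split.
- by move=> [|[|i]] //=; exact: bounded_borel0.
- by apply/trivIsetP => -[|[|i]] [|[|j]] //= _ _ _; rewrite ?set0I ?setI0.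
- by move=> [|[|i]] //=.
- by rewrite big_ord_recl big_ord0 addr0.
Qed.

Lemma complex_radon0 mu : complex_radon_measure mu -> mu set0 = 0.
Proof.
move=> hmu; rewrite part_sum big1// => k _.
by rewrite (real_radon0 (part_radon hmu)) mulr0.
Qed.

Lemma part_le_variation mu k A : complex_radon_measure mu ->
  (upper_variation (part mu k) A <= radon_variation mu A)%E.
Proof.
move=> hmu; apply: ge_ereal_sup => _ [B [bB BA] <-].
apply: le_trans (normc_le_variation (complex_radon0 hmu) bB BA).
rewrite lee_fin /part (le_trans (ler_norm _))// (le_trans (normc_Re _))//.
by rewrite Normc.normcM normcX normcN normc_i expr1n mul1r.
Qed.

(** Jordan decomposition on bounded sets: nu B is nu A minus nu of the complement of
    B in A, so the two suprema differ by nu A. *)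
Lemma upper_variation_jordan (nu : set R -> R) A : real_radon nu ->
  bounded_borel A ->
  (upper_variation nu A = (nu A)%:E + upper_variation (fun B => - nu B)%R A)%E.
Proof.
move=> hnu bA; apply/eqP; rewrite eq_le; apply/andP; split.
  apply: ge_ereal_sup => _ [B [bB BA] <-].
  have bAB : bounded_borel (A `\` B).
    by apply: (bounded_borel_sub _ _ bA); [apply: measurableD; [exact: bA.1|exact: bB.1]|exact: subDsetl].
  rewrite (real_radonD hnu bA bB BA) EFinD -addeA leeDl//.
  rewrite -[leLHS]/(0%:E) -(subrr (nu (A `\` B))) EFinD leeD2l//.
  exact: (@upper_variation_ub _ (fun B => - nu B)).
rewrite addeC -leeBrDr//; apply: ge_ereal_sup => _ [B [bB BA] <-].
have bAB : bounded_borel (A `\` B).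
  by apply: (bounded_borel_sub _ _ bA); [apply: measurableD; [exact: bA.1|exact: bB.1]|exact: subDsetl].
rewrite leeBrDr// -EFinD (real_radonD hnu bA bB BA) addrA addNr add0r.
by apply: upper_variation_ub => //; exact: subDsetl.
Qed.

End part.

(** * Halving the atom at 0 *)

Section halve.
Context {R : realType}.
Implicit Types (mu : set R -> R[i]) (A B : set R).

Lemma complex_radonD mu A B : complex_radon_measure mu ->
  bounded_borel A -> bounded_borel B -> B `<=` A -> mu A = mu B + mu (A `\` B).
Proof.
move=> hmu bA bB BA; rewrite 3!(part_sum mu) -big_split /=; apply: eq_bigr => k _.
by rewrite -mulrDr -rmorphD (real_radonD (part_radon hmu) bA bB BA).
Qed.

Lemma bounded_borelD1 A x : bounded_borel A -> bounded_borel (A `\ x).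
Proof.
move=> bA; apply: (bounded_borel_sub _ _ bA); last exact: subDsetl.
by apply: measurableD => //; exact: bA.1.
Qed.

Lemma bounded_borel_set1 (x : R) : bounded_borel [set x].
Proof. by rewrite -set_itv1; exact: bounded_borel_itv. Qed.

(** Halving the atom is averaging mu with its restriction to the complement of 0;
    additivity and variation bounds are then inherited at once. *)
Lemma halve_at0E mu A : complex_radon_measure mu -> bounded_borel A ->
  halve_at0 mu A = 2^-1 * mu A + 2^-1 * mu (A `\ 0).
Proof.
move=> hmu bA; rewrite /halve_at0 indicE; case: (boolP (0 \in A)) => [/set_mem A0|/negP nA0].
  have sA0 : [set 0] `<=` A by move=> _ ->.
  rewrite (complex_radonD hmu bA (bounded_borel_set1 0) sA0).
  rewrite mulr1; set a := mu _; set b := mu _.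
  by apply/eqP; rewrite -subr_eq0; apply/eqP; field.
rewrite not_setD1; last by move=> /mem_set.
by rewrite mulr0 subr0 -mulrDl; set a := mu A; field.
Qed.

Lemma halve_at0_radon mu : complex_radon_measure mu -> complex_radon_measure (halve_at0 mu).
Proof.
move=> hmu F bF tF bU; rewrite halve_at0E//.
have bF' n := bounded_borelD1 0 (bF n).
have -> : series (fun n => halve_at0 mu (F n) : R[i]^o) =
   (fun n => (2^-1 : R[i]) *: series (fun n => mu (F n) : R[i]^o) n +
             (2^-1 : R[i]) *: series (fun n => mu (F n `\ 0) : R[i]^o) n).
  apply/funext => n; rewrite /series /= !scaler_sumr -big_split /=.
  by apply: eq_bigr => i _; rewrite halve_at0E.
apply: cvgD; apply: cvgZl_tmp; first exact: hmu.
rewrite setD_bigcupl; apply: hmu => //; last by rewrite -setD_bigcupl; exact: bounded_borelD1.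
exact: trivIset_setIr.
Qed.

Lemma halve_at0_variation mu A : complex_radon_measure mu ->
  (radon_variation (halve_at0 mu) A <= radon_variation mu A)%E.
Proof.
move=> hmu; apply: ge_ereal_sup => _ [n [F [bF tF FA ->]]].
have h1 : ((\sum_(i < n) normc (mu (F i)))%:E <= radon_variation mu A)%E.
  by apply: ereal_sup_ubound; exists n, F; split.
have h2 : ((\sum_(i < n) normc (mu (F i `\ 0)))%:E <= radon_variation mu A)%E.
  apply: ereal_sup_ubound; exists n, (fun i => F i `\ 0); split => //.
  - by move=> i; exact: bounded_borelD1.
  - exact: trivIset_setIr.
  - by move=> i; apply: subset_trans (FA i); exact: subDsetl.
have h3 : \sum_(i < n) normc (halve_at0 mu (F i)) <=
   2^-1 * (\sum_(i < n) normc (mu (F i)) + \sum_(i < n) normc (mu (F i `\ 0))).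
  rewrite -big_split /= mulr_sumr; apply: ler_sum => i _.
  rewrite halve_at0E// -mulrDr Normc.normcM.
  have -> : (2^-1 : R[i]) = (2^-1 : R)%:C by rewrite fmorphV rmorph_nat.
  by rewrite normcR ger0_norm// ler_wpM2l// ler_normcD.
move: h1 h2; case: (radon_variation mu A) => [r| |]//; rewrite ?leey// !lee_fin.
by move=> h1 h2; lra.
Qed.

(** The only subsets of a singleton are the singleton and the empty set. *)
Lemma upper_variation_set1 (nu : set R -> R) x : real_radon nu ->
  upper_variation nu [set x] = (Num.max 0 (nu [set x]))%:E.
Proof.
move=> hnu; apply/eqP; rewrite eq_le; apply/andP; split.
  apply: ge_ereal_sup => _ [B [bB /subset_set1[]->] <-]; rewrite lee_fin le_max ?lexx ?orbT//.
  by rewrite real_radon0// lexx.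
rewrite /Num.max; case: ifPn => _; last by rewrite upper_variation_ge0.
by apply: upper_variation_ub => //; exact: bounded_borel_set1.
Qed.

Lemma part_halve0 mu k : complex_radon_measure mu ->
  part (halve_at0 mu) k [set 0] = 2^-1 * part mu k [set 0].
Proof.
move=> hmu; rewrite /part halve_at0E//; last exact: bounded_borel_set1.
rewrite setDv (complex_radon0 hmu) mulr0 addr0 mulrCA.
have -> : (2^-1 : R[i]) = (2^-1 : R)%:C by rewrite fmorphV rmorph_nat.
by rewrite ReM /= mul0r subr0.
Qed.

Lemma upper_variation_halve0 mu k : complex_radon_measure mu ->
  upper_variation (part (halve_at0 mu) k) [set 0] =
  ((2^-1)%:E * upper_variation (part mu k) [set 0%R])%E.
Proof.
move=> hmu; rewrite !upper_variation_set1; [|exact: part_radon|exact/part_radon/halve_at0_radon].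
by rewrite part_halve0// -EFinM maxr_pMr// mulr0.
Qed.

Lemma upper_variation_halve mu k A : complex_radon_measure mu -> ~ A 0 ->
  upper_variation (part (halve_at0 mu) k) A = upper_variation (part mu k) A.
Proof.
move=> hmu A0; rewrite /upper_variation; congr ereal_sup; apply/seteqP.
have E B : B `<=` A -> part (halve_at0 mu) k B = part mu k B.
  move=> BA; rewrite /part /halve_at0 indicE memNset ?mulr0 ?subr0//.
  by move=> /BA.
by split=> _ [B [bB BA] <-]; exists B => //; rewrite E.
Qed.

(** The bound on the variation of mu over unit intervals is passed on to the four
    positive measures; it makes them sigma-finite. *)
Lemma jordan_measures mu M : complex_radon_measure mu ->
  (forall alpha beta : R, beta - alpha <= 1 ->
    (radon_variation mu `[alpha, beta] <= M%:E)%E) ->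
  exists p : nat -> {sigma_finite_measure set R -> \bar R},
    (forall k, upper_variation (part mu k) = p k :> (set R -> \bar R)) /\
    (forall k (alpha beta : R), beta - alpha <= 1 ->
      (p k `[alpha, beta]%classic <= M%:E)%E).
Proof.
move=> hmu hM.
have ub k alpha beta : beta - alpha <= 1 ->
   (upper_variation (part mu k) `[alpha, beta] <= M%:E)%E.
  by move=> h; apply: (le_trans (part_le_variation k _ hmu)); exact: hM.
have /choice[p pE] : forall k, exists q : {sigma_finite_measure set R -> \bar R},
    upper_variation (part mu k) = q :> (set R -> \bar R).
  move=> k; apply: upper_variation_measure; first exact: part_radon.
  by move=> x; apply: le_lt_trans (ltry M); apply: ub; rewrite addrAC subrr add0r.
by exists p; split => // k alpha beta h; rewrite -pE; exact: ub.
Qed.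

End halve.

(** * Exponential weights and complex-valued integrals *)

(** A geometric sum is at most 1 / (1 - e^(-c)), and e^c >= 1 + c. This is where the
    shape 1 + 1 / |y| of the growth estimate comes from. *)
Lemma geo_sum_le {R : realType} (c : R) n : 0 < c ->
  \sum_(k < n) expR (- c * k%:R) <= 1 + c^-1.
Proof.
move=> c0; suff H : \sum_(k < n) expR (- c * k%:R) <= (1 + c^-1) * (1 - expR (- c * n%:R)).
  have := expR_gt0 (- c * n%:R); have : 0 < 1 + c^-1 by rewrite addr_gt0// invr_gt0.
  move: H; set S := \sum_(_ < _) _; nra.
elim: n => [|n IH]; first by rewrite big_ord0 mulr0 expR0 subrr mulr0.
rewrite big_ord_recr /=; apply: le_trans (lerD IH (lexx _)) _.
have -> : - c * n.+1%:R = - c * n%:R - c by rewrite -natr1; ring.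
rewrite expRD; set e := expR (_ * _).
have e0 : 0 < e by exact: expR_gt0.
have key : (1 + c^-1) * expR (- c) <= c^-1.
  have h : expR (- c) <= (1 + c)^-1.
    rewrite expRN lef_pV2 ?posrE ?expR_gt0 ?addr_gt0//; exact: expR_ge1Dx.
  have -> : 1 + c^-1 = (1 + c) * c^-1 by field; rewrite gt_eqF.
  rewrite mulrAC -[leRHS]mul1r ler_wpM2r ?invr_ge0 ?(ltW c0)//.
  have c1 : 0 < 1 + c by rewrite addr_gt0.
  by have := ler_wpM2l (ltW c1) h; rewrite mulfV ?lt0r_neq0.
have := mulr_ge0 (ltW e0) (_ : 0 <= c^-1 - (1 + c^-1) * expR (- c)).
by rewrite subr_ge0 => /(_ key); lra.
Qed.

Section decay.
Context {R : realType} (p : {measure set R -> \bar R}) (M : R).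
Hypothesis hp : forall a b : R, b - a <= 1 -> (p `[a, b]%classic <= M%:E)%E.

Lemma unit_bound_ge0 : 0 <= M.
Proof. by rewrite -lee_fin (le_trans _ (@hp 0 0 _))// subrr. Qed.

Lemma measurable_expdist (c s : R) : measurable_fun setT (fun x : R => expR (- c * `|x - s|)).
Proof.
apply: measurableT_comp => //; apply: measurable_funM => //.
by apply: measurableT_comp => //; exact: measurable_funB.
Qed.

(** The line is cut into the sets where |x - s| lies in [k, k + 1), which have
    mass at most 2 M, and the resulting geometric series is summed. The bound does
    not depend on s. *)
Lemma exp_integral_bound (c s : R) : 0 < c ->
  (\int[p]_x (expR (- c * `|x - s|))%:E <= (2 * M * (1 + c^-1))%:E)%E.
Proof.
move=> c0; pose F (k : nat) : set R := [set x | k%:R <= `|x - s| < k.+1%:R].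
have mF k : measurable (F k).
  have -> : F k = setT `&` (fun x => `|x - s|) @^-1` `[k%:R, k.+1%:R[.
    by rewrite setTI; apply/seteqP; split => x; rewrite /F /= in_itv.
  suff : measurable_fun setT (fun x : R => `|x - s|) by apply.
  by apply: measurableT_comp => //; exact: measurable_funB.
have UF : \bigcup_k F k = setT.
  rewrite -subTset => x _; exists (Num.truncn `|x - s|) => //.
  by rewrite /F /= truncn_itv.
have tF : trivIset setT F.
  move=> i j _ _ [x [/andP[i1 i2] /andP[j1 j2]]].
  have := le_lt_trans i1 j2; have := le_lt_trans j1 i2; rewrite !ltr_nat !ltnS => h1 h2.
  by apply/eqP; rewrite eqn_leq h1 h2.
have mE D : measurable_fun D (fun x : R => (expR (- c * `|x - s|))%:E).
  by apply/measurable_EFinP; apply: measurable_funTS; exact: measurable_expdist.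
rewrite -UF ge0_integral_bigcup//.
apply: lime_le.
  by apply: is_cvg_nneseries => i _ _; apply: integral_ge0 => x _; rewrite lee_fin expR_ge0.
apply: nearW => n.
have pF k : (p (F k) <= (2 * M)%:E)%E.
  have : F k `<=` `[s + k%:R, s + k.+1%:R] `|` `[s - k.+1%:R, s - k%:R].
    move=> x; rewrite /F /= => /andP[h1 h2]; rewrite !in_itv /=.
    by have [h|h] := lerP 0 (x - s); [left|right]; move: h1 h2; rewrite ?(ger0_norm h) ?(ltr0_norm h) => *; apply/andP; split; lra.
  move=> /(le_measure p (mem_set (mF k))) => /(_ (mem_set _))/le_trans; apply.
    exact: measurableU.
  apply: le_trans (measureU2 _ _ _) _ => //.
  have -> : 2 * M = M + M by lra.
  by rewrite EFinD; apply: leeD; apply: hp; rewrite -natr1; lra.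
apply: (@le_trans _ _ (\sum_(0 <= k < n) (expR (- c * k%:R) * (2 * M))%:E)%E).
  apply: lee_sum => k _; apply: (@le_trans _ _ (\int[p]_(x in F k) cst (expR (- c * k%:R))%:E x)%E).
    apply: ge0_le_integral => //.
    move=> x /andP[h _]; rewrite lee_fin ler_expR /=. rewrite ler_nM2l ?oppr_lt0//.
  by rewrite integral_cst// EFinM; apply: lee_pmul.
rewrite sumEFin lee_fin -mulr_suml big_mkord mulrC.
by apply: ler_wpM2l; [exact: mulr_ge0 unit_bound_ge0|exact: geo_sum_le].
Qed.

Lemma exp_integrable (c s : R) : 0 < c ->
  p.-integrable setT (fun x : R => (expR (- c * `|x - s|))%:E).
Proof.
move=> c0; apply/integrableP; split; first by apply/measurable_EFinP; exact: measurable_expdist.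
under eq_integral do rewrite gee0_abs ?lee_fin ?expR_ge0//.
by apply: le_lt_trans (exp_integral_bound s c0) _; exact: ltry.
Qed.

End decay.

Section cint.
Context {R : realType}.

Definition cmeasurable (f : R -> R[i]) : Prop :=
  measurable_fun setT (fun x => complex.Re (f x)) /\
  measurable_fun setT (fun x => complex.Im (f x)).

Lemma cmeasurableD f g : cmeasurable f -> cmeasurable g -> cmeasurable (fun x => f x + g x).
Proof.
move=> [f1 f2] [g1 g2]; split.
  by under eq_fun do rewrite ReD; exact: measurable_funD.
by under eq_fun do rewrite ImD; exact: measurable_funD.
Qed.

Lemma cmeasurableM f g : cmeasurable f -> cmeasurable g -> cmeasurable (fun x => f x * g x).
Proof.
move=> [f1 f2] [g1 g2]; split.
  by under eq_fun do rewrite ReM; apply: measurable_funB; exact: measurable_funM.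
by under eq_fun do rewrite ImM; apply: measurable_funD; exact: measurable_funM.
Qed.

Lemma cmeasurable_cst (c : R[i]) : cmeasurable (fun=> c).
Proof. by split; exact: measurable_cst. Qed.

Lemma cmeasurableZ c f : cmeasurable f -> cmeasurable (fun x => c * f x).
Proof. by apply: cmeasurableM; exact: cmeasurable_cst. Qed.

Lemma cmeasurable_comp f (u : R -> R) : cmeasurable f -> measurable_fun setT u ->
  cmeasurable (f \o u).
Proof. by move=> [f1 f2] mu; split; [exact: (measurableT_comp f1)|exact: (measurableT_comp f2)]. Qed.

Context (m : {measure set R -> \bar R}).
Variables (D : set R) (mD : measurable D).
Implicit Types f g : R -> R[i].

Lemma cintegrableD f g : cintegrable m D f -> cintegrable m D g ->
  cintegrable m D (fun x => f x + g x).
Proof.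
move=> [f1 f2] [g1 g2]; split.
  by under eq_fun do rewrite ReD EFinD; exact: integrableD.
by under eq_fun do rewrite ImD EFinD; exact: integrableD.
Qed.

Lemma cintegrableZ c f : cintegrable m D f -> cintegrable m D (fun x => c * f x).
Proof.
move=> [f1 f2]; split.
  by under eq_fun do rewrite ReM EFinB !EFinM; apply: integrableB => //; exact: integrableZl.
by under eq_fun do rewrite ImM EFinD !EFinM; apply: integrableD => //; exact: integrableZl.
Qed.

Lemma cintegralD f g : cintegrable m D f -> cintegrable m D g ->
  cintegral m D (fun x => f x + g x) = cintegral m D f + cintegral m D g.
Proof.
move=> [f1 f2] [g1 g2]; apply/eqP; rewrite eq_complex /= ; apply/andP; split; apply/eqP.
  by rewrite -[RHS]RintegralD//; apply: eq_Rintegral => x _; rewrite ReD.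
by rewrite -[RHS]RintegralD//; apply: eq_Rintegral => x _; rewrite ImD.
Qed.

Lemma cintegralZ c f : cintegrable m D f ->
  cintegral m D (fun x => c * f x) = c * cintegral m D f.
Proof.
move=> [f1 f2]; apply/eqP; rewrite eq_complex; case: c => a b /=; apply/andP; split; apply/eqP.
  rewrite -(RintegralZl a mD f1) -(RintegralZl b mD f2) -RintegralB//.
  - by apply: eq_Rintegral => x _; rewrite ReM.
  - exact: (integrableZl mD a f1).
  - exact: (integrableZl mD b f2).
rewrite -(RintegralZl b mD f1) -(RintegralZl a mD f2) -RintegralD//.
- by apply: eq_Rintegral => x _; rewrite ImM.
- exact: (integrableZl mD a f2).
- exact: (integrableZl mD b f1).
Qed.

Lemma cintegrable_sum n (F : nat -> R -> R[i]) : (forall k, cintegrable m D (F k)) ->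
  cintegrable m D (fun x => \sum_(k < n) F k x).
Proof.
move=> h; elim: n => [|n IH].
  by under eq_fun do rewrite big_ord0; split; exact: integrable0.
by under eq_fun do rewrite big_ord_recr; exact: cintegrableD.
Qed.

Lemma cintegral0 : cintegral m D (fun=> 0) = 0.
Proof. by rewrite /cintegral /= integral0. Qed.

Lemma cintegral_sum n (F : nat -> R -> R[i]) : (forall k, cintegrable m D (F k)) ->
  cintegral m D (fun x => \sum_(k < n) F k x) = \sum_(k < n) cintegral m D (F k).
Proof.
move=> h; elim: n => [|n IH].
  by under eq_fun do rewrite big_ord0; rewrite cintegral0 big_ord0.
under eq_fun do rewrite big_ord_recr; rewrite cintegralD//; last exact: cintegrable_sum.
by rewrite IH big_ord_recr.
Qed.

Lemma cintegrable_le f (g : R -> R) : cmeasurable f ->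
  m.-integrable D (fun x => (g x)%:E) -> (forall x, D x -> normc (f x) <= g x) ->
  cintegrable m D f.
Proof.
move=> [f1 f2] ig fg; split; apply: le_integrable ig => //.
- by apply/measurable_EFinP; exact: measurable_funTS.
- by move=> x Dx; rewrite lee_fin (le_trans (normc_Re _))// (le_trans (fg x Dx))// ler_norm.
- by apply/measurable_EFinP; exact: measurable_funTS.
- by move=> x Dx; rewrite lee_fin (le_trans (normc_Im _))// (le_trans (fg x Dx))// ler_norm.
Qed.

Lemma normc_cintegral_le f (g : R -> R) : cintegrable m D f ->
  m.-integrable D (fun x => (g x)%:E) -> (forall x, D x -> normc (f x) <= g x) ->
  normc (cintegral m D f) <= 2 * Rintegral m D g.
Proof.
move=> [f1 f2] ig fg; apply: le_trans (normc_le _) _; rewrite mulrDl !mul1r.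
apply: lerD; apply: (le_trans (le_normr_Rintegral _ _)) => //; apply: le_Rintegral => //.
- exact: (integrable_norm f1).
- by move=> x Dx; rewrite (le_trans (normc_Re _))// fg.
- exact: (integrable_norm f2).
- by move=> x Dx; rewrite (le_trans (normc_Im _))// fg.
Qed.

End cint.

(** * Reflection of Lebesgue measure and exchange of integrals *)

Section lebesgue.
Context {R : realType}.

(** Uniqueness of Lebesgue measure on half-open intervals. *)
Lemma lebesgue_reflection (a : R) (A : set R) : measurable A ->
  lebesgue_measure ((fun x => a - x) @^-1` A) = lebesgue_measure A.
Proof.
move=> mA; pose r : measurableTypeR R -> measurableTypeR R := fun x : R => a - x.
have mr : measurable_fun setT r by exact: (@measurable_funB _ R R).
suff : pushforward lebesgue_measure r A = lebesgue_measure A by [].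
apply/esym/lebesgue_measure_unique => //= _ [[b c]] _ <-.
rewrite /pushforward /=.
have -> : r @^-1` `]b, c] = `[a - c, a - b[%classic.
  by apply/seteqP; split => x; rewrite /= !in_itv /r /= => /andP[h1 h2]; apply/andP; split; lra.
rewrite !lebesgue_measure_itv/= !lte_fin.
have -> : (a - c < a - b) = (b < c) by rewrite ltrD2l ltrN2.
by case: ifP => // _; rewrite -!EFinB; congr (_%:E); lra.
Qed.

(** Lebesgue measure is canonically a measure on a copy of the line with another
    display; this transports it to the measurable structure of R itself. *)
Lemma lebesgue_sigma_finite_measure :
  exists L : {sigma_finite_measure set R -> \bar R}, L = lebesgue_measure :> (set R -> \bar R).
Proof.
have la : semi_sigma_additive (lebesgue_measure : set R -> \bar R).
  exact: (@measure_semi_sigma_additive _ (measurableTypeR R) R lebesgue_measure).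
have l0 : lebesgue_measure (set0 : set R) = 0%E by exact: measure0.
have lp (A : set R) : (0 <= lebesgue_measure A)%E by exact: measure_ge0.
pose l : set R -> \bar R := lebesgue_measure.
pose p : {measure set R -> \bar R} := HB.pack l (isMeasure.Build _ _ _ l l0 lp la).
have sf : sigma_finite (setT : set R) p.
  by have [F F1 F2] := @sigma_finiteT _ (measurableTypeR R) R lebesgue_measure; exists F.
pose s : {sigma_finite_measure set R -> \bar R} :=
  HB.pack (p : set R -> \bar R) p (Measure_isSigmaFinite.Build _ _ _ p sf).
by exists s.
Qed.

End lebesgue.

Section integrable_mono.
Context {R : realType} (p : {measure set R -> \bar R}) (nu : set R -> \bar R).
Hypotheses (nu0 : nu set0 = 0%E) (pnu : forall A, (p A <= nu A)%E).
Import HBNNSimple.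

Let sintegralE_set_fun (m : set R -> \bar R) (f : {nnsfun R >-> R}) : m set0 = 0%E ->
  sintegral m f = (\sum_(x \in range f) x%:E * m (f @^-1` [set x]))%E.
Proof.
move=> m0; rewrite /sintegral [RHS](fsbig_widen _ setT)//= => x [_ Nfx] /=.
by rewrite preimage10// m0 mule0.
Qed.

Lemma le_sintegral_set_fun (f : {nnsfun R >-> R}) : (sintegral p f <= sintegral nu f)%E.
Proof.
rewrite !sintegralE_set_fun// lee_fsum// => r [t _ <-].
by rewrite lee_wpmul2l// lee_fin.
Qed.

(** Integrability against a set function that need not be a measure, such as the
    total variation here, passes to every measure that it dominates: integrals of
    nonnegative functions are suprema of sums which are monotone in the set
    function. *)
Lemma integrable_set_fun D (f : R -> \bar R) : measurable D ->
  nu.-integrable D f -> p.-integrable D f.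
Proof.
move=> mD /integrableP[mf fin]; apply/integrableP; split => //; apply: le_lt_trans fin.
rewrite ge0_integralE// /integral.
set g := (fun x => _) \_ D.
have g0 x : (0 <= g x)%E by rewrite /g patchE; case: ifP.
have gneg : (g^\-)%E = cst 0%E by apply/funext => x; rewrite funenegE max_r// oppe_le0.
have gpos : (g^\+)%E = g by apply/funext => x; rewrite funeposE max_l.
rewrite gneg gpos.
set Z := ereal_sup [set sintegral nu h | h in [set h : {nnsfun R >-> R} | forall x, ((h x)%:E <= cst 0 x)%E]].
have -> : Z = 0%E.
  apply/eqP; rewrite eq_le; apply/andP; split.
    apply: ge_ereal_sup => _ [h h0 <-].
    have hE : (h : R -> R) = cst 0.
      by apply/funext => x; apply/eqP; rewrite eq_le -lee_fin h0 /=.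
    rewrite sintegralE_set_fun// fsbig1// => r [t _ <-].
    by rewrite hE /= mul0e.
  apply: ereal_sup_ubound; exists nnsfun0 => //.
  rewrite sintegralE_set_fun// fsbig1// => r [t _ <-].
  by rewrite mul0e.
rewrite sube0; apply: ge_ereal_sup => _ [h hg <-].
apply: le_trans (le_sintegral_set_fun h) _.
by apply: ereal_sup_ubound; exists h.
Qed.

End integrable_mono.

Section swap.
Context {R : realType} (L p : {sigma_finite_measure set R -> \bar R}).
Hypothesis hL : forall (a : R) (A : set R), measurable A ->
  L ((fun x => a - x) @^-1` A) = L A.

(** For nonnegative functions the measure is its own push-forward by the reflection;
    the general case follows by splitting into positive and negative parts. *)
Lemma integral_reflection (a : R) (f : R -> \bar R) : measurable_fun setT f ->
  (\int[L]_x f (a - x)%R = \int[L]_x f x)%E.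
Proof.
pose r : R -> R := fun x => a - x.
have mr : measurable_fun setT r by exact: measurable_funB.
have ge0 g : measurable_fun setT g -> (forall x, 0 <= g x)%E ->
    (\int[L]_x g (a - x)%R = \int[L]_x g x)%E.
  move=> mg g0.
  have := @ge0_integral_pushforward _ _ _ _ _ r mr L setT g measurableT mg (fun x _ => g0 x).
  rewrite preimage_setT => <-.
  by apply: eq_measure_integral => A mA _; exact: hL.
move=> mf; rewrite integralE [RHS]integralE; congr (_ - _)%E.
  rewrite -[RHS]ge0//; last exact: measurable_funepos.
  by apply: eq_integral => x _; rewrite !funeposE.
rewrite -[RHS]ge0//; last exact: measurable_funeneg.
by apply: eq_integral => x _; rewrite !funenegE.
Qed.

Variables (k e : R -> R) (B s : R).
Hypotheses (hk : L.-integrable setT (EFin \o k)) (me : measurable_fun setT e).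
Hypothesis hB : forall u : R, (\int[p]_t (`|e (t - u)|)%:E <= B%:E)%E.
Hypothesis hkp : forall u : R, p.-integrable setT (fun t => (k (t - u))%:E).

Let F1 (z : R * R) : \bar R := (k z.1 * e (z.2 - s - z.1))%:E.
Let F2 (z : R * R) : \bar R := (e z.1 * k (z.2 - s - z.1))%:E.

Let mk : measurable_fun setT k.
Proof. by apply/measurable_EFinP; exact: measurable_int hk. Qed.

Let mshift (f : R -> R) : measurable_fun setT f ->
  measurable_fun setT (fun z : R * R => f (z.2 - s - z.1)).
Proof.
move=> mf; apply: (@measurableT_comp _ _ _ _ _ _ f) => //.
by apply: measurable_funB => //; exact: measurable_funB.
Qed.

Let mF1 : measurable_fun setT F1.
Proof.
apply/measurable_EFinP; apply: measurable_funM; last exact: mshift.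
exact: measurableT_comp.
Qed.

Let mF2 : measurable_fun setT F2.
Proof.
apply/measurable_EFinP; apply: measurable_funM; last exact: mshift.
exact: measurableT_comp.
Qed.

Let mF1t t : measurable_fun setT (fun x : R => F1 (x, t)).
Proof.
apply/measurable_EFinP; apply: measurable_funM => //.
apply: (@measurableT_comp _ _ _ _ _ _ e) => //=.
by apply: measurable_funB => //; exact: measurable_cst.
Qed.

Let ie u : p.-integrable setT (fun t => (e (t - u))%:E).
Proof.
apply/integrableP; split.
  by apply/measurable_EFinP; apply: measurableT_comp => //; exact: measurable_funB.
by apply: le_lt_trans (hB u) _; exact: ltry.
Qed.

Let subsub (t x : R) : t - s - x = t - (s + x). Proof. by rewrite opprD addrA. Qed.

Let iF1 : (L \x p)%E.-integrable setT F1.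
Proof.
apply/(integrable12ltyP L p mF1).
apply: (@le_lt_trans _ _ (\int[L]_x (B%:E * `|(k x)%:E|))%E).
  apply: ge0_le_integral => //.
  - by move=> x _; apply: integral_ge0 => y _; exact: abse_ge0.
  - have mF : measurable_fun setT (fun z : R * R => `|F1 z|%E) by exact: measurableT_comp.
    exact: (measurable_fun_fubini_tonelli_F (m2 := p) _ mF (fun x => abse_ge0 _)).
  - by apply: emeasurable_funM => //; apply: measurableT_comp => //; exact: measurable_int hk.
  move=> x _; rewrite /F1 /=.
  under eq_integral do rewrite normrM EFinM subsub.
  rewrite ge0_integralZl//; last first.
    apply/measurable_EFinP; apply: measurableT_comp => //.
    by apply: measurableT_comp => //; exact: measurable_funB.
  by rewrite muleC lee_wpmul2r//; exact: hB.
rewrite ge0_integralZl//.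
- apply: lte_mul_pinfty => //; last by have /integrableP[] := hk.
  by rewrite (le_trans _ (hB 0))//; apply: integral_ge0.
- by apply: measurableT_comp => //; exact: measurable_int hk.
- by rewrite (le_trans _ (hB 0))//; apply: integral_ge0.
Qed.

Let iF2 : (L \x p)%E.-integrable setT F2.
Proof.
apply/(integrable21ltyP L p mF2).
have /(integrable21ltyP L p mF1) := iF1; apply: le_lt_trans.
rewrite le_eqVlt; apply/orP; left; apply/eqP; apply: eq_integral => t _.
rewrite -[RHS](integral_reflection (t - s)).
  by apply: eq_integral => x _; rewrite /F1 /F2 /= subKr mulrC.
by apply: measurableT_comp => //; exact: mF1t.
Qed.

Let F1E x : fubini_F p F1 x = (k x * Rintegral p setT (fun t => e (t - (s + x))))%:E.
Proof.
rewrite /fubini_F /F1 /=; under eq_integral do rewrite EFinM subsub.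
rewrite integralZl// EFinM fineK//.
exact: integrable_fin_num.
Qed.

Let F2E x : fubini_F p F2 x = (e x * Rintegral p setT (fun t => k (t - (s + x))))%:E.
Proof.
rewrite /fubini_F /F2 /=; under eq_integral do rewrite EFinM subsub.
rewrite integralZl// EFinM fineK//.
exact: integrable_fin_num.
Qed.

Lemma swap_integrable1 :
  L.-integrable setT (fun x => (k x * Rintegral p setT (fun t => e (t - (s + x))))%:E).
Proof. by have := integrable_fubini_F iF1; rewrite (funext F1E). Qed.

Lemma swap_integrable2 :
  L.-integrable setT (fun x => (e x * Rintegral p setT (fun t => k (t - (s + x))))%:E).
Proof. by have := integrable_fubini_F iF2; rewrite (funext F2E). Qed.

(** Correlating k with the correlation of p and e is the same as correlating e with
    the correlation of p and k: Fubini in both orders, around a reflection in the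
    Lebesgue variable. *)
Lemma swapE : Rintegral L setT (fun x => k x * Rintegral p setT (fun t => e (t - (s + x)))) =
  Rintegral L setT (fun x => e x * Rintegral p setT (fun t => k (t - (s + x)))).
Proof.
congr fine; under eq_integral do rewrite -F1E; under [RHS]eq_integral do rewrite -F2E.
(* both sides become integrals over t first, where x |-> t - s - x exchanges
   the two integrands *)
rewrite (integral12_prod_meas1 iF1) (integral12_prod_meas1 iF2).
rewrite -(integral21_prod_meas1 iF1) -(integral21_prod_meas1 iF2).
apply: eq_integral => t _; rewrite /fubini_G -[LHS](integral_reflection (t - s)).
  by apply: eq_integral => x _; rewrite /F1 /F2 /= subKr mulrC.
exact: mF1t.
Qed.

End swap.

(** * Exponentially decaying kernels *)

(** Exponentially decaying kernels, stable under all operations below and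
    integrable against every measure of bounded mass on unit intervals. *)
Definition exp_decay {R : realType} (E : R -> R[i]) : Prop :=
  cmeasurable E /\ exists A c : R, 0 < c /\ forall x, normc (E x) <= A * expR (- c * `|x|).

Section kernel.
Context {R : realType} (M : R).
Context (q : {measure set R -> \bar R}).
Hypothesis hq : forall a b : R, b - a <= 1 -> (q `[a, b]%classic <= M%:E)%E.

Lemma cmeasurable_shift (E : R -> R[i]) s : cmeasurable E -> cmeasurable (fun t => E (t - s)).
Proof. by move=> mE; apply: (cmeasurable_comp mE); exact: measurable_funB. Qed.

Lemma exp_decay_integrable (E : R -> R[i]) s : exp_decay E -> cintegrable q setT (fun t => E (t - s)).
Proof.
move=> [mE [A [c [c0 EA]]]]; apply: (cintegrable_le measurableT (g := fun t => A * expR (- c * `|t - s|))).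
- exact: cmeasurable_shift.
- by apply: (integrableZl measurableT A (exp_integrable hq s c0)).
- by move=> x _; exact: EA.
Qed.

Lemma exp_decay_bound (E : R -> R[i]) A c s : cmeasurable E -> 0 < c ->
  (forall x, normc (E x) <= A * expR (- c * `|x|)) ->
  normc (cintegral q setT (fun t => E (t - s))) <= 4 * M * (1 + c^-1) * A.
Proof.
move=> mE c0 EA; have iE : cintegrable q setT (fun t => E (t - s)).
  by apply: exp_decay_integrable; split => //; exists A, c.
have A0 : 0 <= A.
  by have := le_trans (normc_ge0 _) (EA 0); rewrite pmulr_lge0// expR_gt0.
have ie := exp_integrable hq s c0.
apply: le_trans (normc_cintegral_le measurableT iE (g := fun t => A * expR (- c * `|t - s|)) _ _) _.
- exact: (integrableZl measurableT A ie).
- by move=> x _; exact: EA.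
rewrite (RintegralZl A measurableT ie).
have : Rintegral q setT (fun t => expR (- c * `|t - s|)) <= 2 * M * (1 + c^-1).
  rewrite -lee_fin fineK; last exact: integrable_fin_num.
  exact: exp_integral_bound.
set I := Rintegral _ _ _; move=> hI; have := ler_wpM2l A0 hI; lra.
Qed.

End kernel.

Section correlation_swap.
Context {R : realType} (L q : {sigma_finite_measure set R -> \bar R}) (M : R).
Hypothesis hL : forall (a : R) (A : set R), measurable A ->
  L ((fun x => a - x) @^-1` A) = L A.
Hypothesis hq : forall a b : R, b - a <= 1 -> (q `[a, b]%classic <= M%:E)%E.
Variables (K E : R -> R[i]) (s : R).
Hypotheses (hK : cintegrable L setT K) (hE : exp_decay E).
Hypothesis hqK : forall u, cintegrable q setT (fun t => K (t - u)).

Let abs_ub (f : R -> R) : measurable_fun setT f -> (forall x, `|f x| <= normc (E x)) ->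
  exists B, forall u : R, (\int[q]_t (`|f (t - u)|)%:E <= B%:E)%E.
Proof.
move=> mf fE; have [mE [A [c [c0 EA]]]] := hE; exists (A * (2 * M * (1 + c^-1))) => u.
have A0 : 0 <= A.
  by have := le_trans (normc_ge0 _) (EA 0); rewrite pmulr_lge0// expR_gt0.
apply: (@le_trans _ _ (\int[q]_t (A%:E * (expR (- c * `|t - u|))%:E))%E).
  apply: ge0_le_integral => //.
  - apply/measurable_EFinP; apply: measurableT_comp => //.
    by apply: (measurableT_comp mf); exact: measurable_funB.
  - by apply/measurable_EFinP; apply: measurable_funM => //; exact: measurable_expdist.
  - by move=> x _; rewrite -EFinM lee_fin (le_trans (fE _)).
rewrite ge0_integralZl//; last by apply/measurable_EFinP; exact: measurable_expdist.
by rewrite EFinM lee_wpmul2l//; exact: exp_integral_bound.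
Qed.

(** The real exchange formula, applied to the four products of components. *)
Lemma correlation_swap :
  [/\ cintegrable L setT (fun x => K x * cintegral q setT (fun t => E (t - (s + x)))),
      cintegrable L setT (fun x => E x * cintegral q setT (fun t => K (t - (s + x))))
    & cintegral L setT (fun x => K x * cintegral q setT (fun t => E (t - (s + x)))) =
      cintegral L setT (fun x => E x * cintegral q setT (fun t => K (t - (s + x))))].
Proof.
have [[m1 m2] _] := hE; have [k1 k2] := hK.
have [B1 hB1] := abs_ub m1 (fun x => normc_Re (E x)).
have [B2 hB2] := abs_ub m2 (fun x => normc_Im (E x)).
have q1 u := (hqK u).1; have q2 u := (hqK u).2.
have a11 := swap_integrable1 s k1 m1 hB1; have a11' := swap_integrable2 hL s k1 m1 hB1 q1.
have a12 := swap_integrable1 s k1 m2 hB2; have a12' := swap_integrable2 hL s k1 m2 hB2 q1.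
have a21 := swap_integrable1 s k2 m1 hB1; have a21' := swap_integrable2 hL s k2 m1 hB1 q2.
have a22 := swap_integrable1 s k2 m2 hB2; have a22' := swap_integrable2 hL s k2 m2 hB2 q2.
split.
- split.
    by under eq_fun do rewrite ReM EFinB; exact: (integrableB measurableT a11 a22).
  by under eq_fun do rewrite ImM EFinD; exact: (integrableD measurableT a12 a21).
- split.
    by under eq_fun do rewrite ReM EFinB; exact: (integrableB measurableT a11' a22').
  by under eq_fun do rewrite ImM EFinD; exact: (integrableD measurableT a21' a12').
apply/eqP; rewrite eq_complex /= ; apply/andP; split; apply/eqP.
  transitivity (Rintegral L setT (fun x => complex.Re (K x) * Rintegral q setT (fun t => complex.Re (E (t - (s + x))))
      - complex.Im (K x) * Rintegral q setT (fun t => complex.Im (E (t - (s + x)))))).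
    by apply: eq_Rintegral => x _; rewrite ReM.
  rewrite (RintegralB measurableT a11 a22).
  rewrite (swapE hL s k1 m1 hB1 q1) (swapE hL s k2 m2 hB2 q2).
  rewrite -(RintegralB measurableT a11' a22').
  by apply: eq_Rintegral => x _; rewrite ReM.
transitivity (Rintegral L setT (fun x => complex.Re (K x) * Rintegral q setT (fun t => complex.Im (E (t - (s + x))))
      + complex.Im (K x) * Rintegral q setT (fun t => complex.Re (E (t - (s + x)))))).
  by apply: eq_Rintegral => x _; rewrite ImM.
rewrite (RintegralD measurableT a12 a21).
rewrite (swapE hL s k1 m2 hB2 q1) (swapE hL s k2 m1 hB1 q2) addrC.
rewrite -(RintegralD measurableT a21' a12').
by apply: eq_Rintegral => x _; rewrite ImM.
Qed.

End correlation_swap.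

(** * Estimates of the complex exponential *)

Section real_exp.
Context {R : realType}.
Implicit Types x y : R.

Lemma expR_B1_le x : `|expR x - 1| <= `|x| * expR `|x|.
Proof.
have h1 := expR_ge1Dx x; have h2 := expR_ge1Dx (- x); rewrite expRN in h2.
have e0 := expR_gt0 x.
have h3 : (1 - x) * expR x <= 1.
  by have := ler_wpM2r (ltW e0) h2; rewrite mulVf ?gt_eqF.
have [x0|x0] := leP 0 x.
  by rewrite (ger0_norm x0) ger0_norm; nra.
have e1 : 1 <= expR `|x| by rewrite -expR0 ler_expR.
have ex1 : expR x - 1 < 0 by rewrite subr_lt0 expR_lt1.
by rewrite (ltr0_norm ex1) (ltr0_norm x0) in e1 *; nra.
Qed.

Lemma expR_B1x_le x : `|expR x - 1 - x| <= x ^+ 2 * expR `|x|.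
Proof.
have h1 := expR_ge1Dx x; have h2 := expR_ge1Dx (- x); rewrite expRN in h2.
have e0 := expR_gt0 x.
have h3 : (1 - x) * expR x <= 1.
  by have := ler_wpM2r (ltW e0) h2; rewrite mulVf ?gt_eqF.
rewrite ger0_norm; last by lra.
have [x0|x0] := leP 0 x.
  rewrite (ger0_norm x0).
  have : expR x - 1 <= x * expR x by lra.
  by move=> /(ler_wpM2l x0); rewrite expr2; nra.
have e1 : 1 <= expR `|x| by rewrite -expR0 ler_expR.
have : expR x - 1 - x <= x ^+ 2 by rewrite expr2; nra.
move=> /le_trans; apply; rewrite -[leLHS]mulr1 ler_wpM2l//; exact: sqr_ge0.
Qed.

Lemma sin_MVT x y : `|sin x - sin y| <= `|x - y|.
Proof.
wlog xy : x y / y <= x.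
  move=> H; have [|/ltW] := leP y x; first by move/H.
  by move/H; rewrite distrC [leRHS]distrC.
have [c _ ->] := @MVT_segment R sin cos y x xy (fun c _ => is_derive_sin c)
  (continuous_subspaceT (@continuous_sin R)).
by rewrite normrM ler_piMl// cos_max.
Qed.

Lemma sin_norm_le x : `|sin x| <= `|x|.
Proof. by have := sin_MVT x 0; rewrite sin0 !subr0. Qed.

Lemma oneB_cos_ge0 x : 0 <= 1 - cos x.
Proof. by rewrite subr_ge0 (le_trans (ler_norm _))// cos_max. Qed.

Lemma oneB_cos x : 1 - cos x = 2 * sin (x / 2) ^+ 2.
Proof.
have -> : cos x = cos ((x / 2) *+ 2) by rewrite -mulr_natr divfK.
by rewrite cos_mulr2n; have := cos2Dsin2 (x / 2); lra.
Qed.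

Lemma oneB_cos_le_sqr x : 1 - cos x <= x ^+ 2.
Proof.
rewrite oneB_cos; have := sin_norm_le (x / 2); move/(@lerXn2r R 2); rewrite !nnegrE !normr_ge0.
move=> /(_ isT isT); rewrite !real_normK ?num_real// exprMn.
have := sqr_ge0 x; have -> : (2^-1 : R) ^+ 2 = 4^-1 by field.
lra.
Qed.

Lemma oneB_cos_le x : 1 - cos x <= `|x|.
Proof.
rewrite oneB_cos; have h1 := sin_norm_le (x / 2); have h2 := sin_max (x / 2).
rewrite -real_normK ?num_real//.
rewrite normrM (ger0_norm (_ : 0 <= 2^-1 :> R)) // in h1.
have := normr_ge0 (sin (x / 2)); set u := `|sin _| in h1 h2 *; nra.
Qed.

(** The mean value theorem gives the difference as x (cos c - 1), and 1 - cos c is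
    at most |c|. *)
Lemma sinBx_le x : `|sin x - x| <= x ^+ 2.
Proof.
wlog x0 : x / 0 <= x.
  move=> H; have [|/ltW x0] := leP 0 x; first by move/H.
  have := H (- x); rewrite oppr_ge0 sinN -opprD normrN sqrrN; exact.
have D (c : R) : is_derive c 1 (fun u : R => sin u - u) (cos c - 1).
  by apply: is_deriveB.
have [c] := @MVT_segment R (fun u => sin u - u) (fun u => cos u - 1) 0 x x0 (fun c _ => D c)
  (derivable_within_continuous (fun c _ => @ex_derive _ _ _ _ _ _ _ (D c))).
rewrite in_itv /= => /andP[c0 cx]; rewrite sin0 !subr0 => ->.
rewrite normrM distrC (ger0_norm (oneB_cos_ge0 c)) (ger0_norm x0) expr2 ler_wpM2r//.
by rewrite (le_trans (oneB_cos_le c))// ger0_norm.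
Qed.

End real_exp.

Section cexp.
Context {R : realType}.
Implicit Types z w : R[i].

Lemma cexpD z w : cexp (z + w) = cexp z * cexp w.
Proof.
case: z => a b; case: w => c d; apply/eqP; rewrite eq_complex /cexp /= expRD cosD sinD.
by apply/andP; split; apply/eqP; ring.
Qed.

Lemma cexp0 : cexp (0 : R[i]) = 1.
Proof. by rewrite /cexp /= expR0 cos0 sin0 !mul1r. Qed.

Lemma normc_cexp z : normc (cexp z) = expR (complex.Re z).
Proof.
rewrite normcE /cexp /= !exprMn -mulrDr cos2Dsin2 mulr1 sqrtr_sqr ger0_norm//.
Qed.

Lemma cexpB1_le z : normc (cexp z - 1) <= 3 * normc z * expR (normc z).
Proof.
apply: le_trans (normc_le _) _; rewrite !ReD !ImD /=.
set x := complex.Re z; set y := complex.Im z.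
have hx : `|x| <= normc z by exact: normc_Re.
have hy : `|y| <= normc z by exact: normc_Im.
have ex : expR `|x| <= expR (normc z) by rewrite ler_expR.
have ex0 := expR_gt0 `|x|; have exx : expR x <= expR `|x| by rewrite ler_expR ler_norm.
have ex1 := expR_gt0 x.
have h1 := expR_B1_le x; have h2 := oneB_cos_le y; have h2' := oneB_cos_ge0 y.
have h3 := sin_norm_le y.
have -> : expR x * cos y - 1 = (expR x - 1) - expR x * (1 - cos y) by ring.
have -> : expR x * sin y + - 0 = expR x * sin y by rewrite subr0.
have l1 : `|expR x - 1 - expR x * (1 - cos y)| <= `|x| * expR `|x| + expR `|x| * `|y|.
  apply: le_trans (ler_normB _ _) _; apply: lerD => //.
  rewrite normrM (gtr0_norm ex1) (ger0_norm h2'); apply: ler_pM => //; exact: ltW.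
have l2 : `|expR x * sin y| <= expR `|x| * `|y|.
  rewrite normrM (gtr0_norm ex1); apply: ler_pM => //; exact: ltW.
have l3 : `|x| * expR `|x| <= normc z * expR (normc z) by apply: ler_pM => //; exact: ltW.
have l4 : expR `|x| * `|y| <= normc z * expR (normc z).
  by rewrite mulrC; apply: ler_pM => //; exact: ltW.
lra.
Qed.

(** Only the order in z matters: this controls the Taylor remainder of the kernels.
    The estimate is reduced to the real exponential, sine and cosine. *)
Lemma cexpB1z_le z : normc (cexp z - 1 - z) <= 4 * normc z ^+ 2 * expR (normc z).
Proof.
apply: le_trans (normc_le _) _; rewrite !ReD !ImD !ReN !ImN /=.
set x := complex.Re z; set y := complex.Im z.
have hx : `|x| <= normc z by exact: normc_Re.
have hy : `|y| <= normc z by exact: normc_Im.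
have ex : expR `|x| <= expR (normc z) by rewrite ler_expR.
have ex0 := expR_gt0 `|x|; have exx : expR x <= expR `|x| by rewrite ler_expR ler_norm.
have ex1 := expR_gt0 x.
have en : 1 <= expR (normc z) by rewrite -expR0 ler_expR normc_ge0.
have h1 := expR_B1x_le x; have h1' := expR_B1_le x.
have h2 := oneB_cos_le_sqr y; have h2' := oneB_cos_ge0 y.
have h3 := sin_norm_le y; have h4 := sinBx_le y.
have sx : x ^+ 2 <= normc z ^+ 2 by rewrite -real_normK ?num_real// lerXn2r ?nnegrE ?normc_ge0.
have sy : y ^+ 2 <= normc z ^+ 2 by rewrite -real_normK ?num_real// lerXn2r ?nnegrE ?normc_ge0.
have -> : expR x * cos y - 1 - x = (expR x - 1 - x) - expR x * (1 - cos y) by ring.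
have -> : expR x * sin y - 0 - y = (expR x - 1) * sin y + (sin y - y) by ring.
have l1 : `|expR x - 1 - x - expR x * (1 - cos y)| <= x ^+ 2 * expR `|x| + expR `|x| * y ^+ 2.
  apply: le_trans (ler_normB _ _) _; apply: lerD => //.
  rewrite normrM (gtr0_norm ex1) (ger0_norm h2'); apply: ler_pM => //; exact: ltW.
have l2 : `|(expR x - 1) * sin y + (sin y - y)| <= `|x| * expR `|x| * `|y| + y ^+ 2.
  apply: le_trans (ler_normD _ _) _; apply: lerD => //.
  by rewrite normrM; apply: ler_pM.
have l3 : x ^+ 2 * expR `|x| <= normc z ^+ 2 * expR (normc z).
  by apply: ler_pM; rewrite ?sqr_ge0 ?expR_ge0.
have l4 : expR `|x| * y ^+ 2 <= normc z ^+ 2 * expR (normc z).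
  by rewrite mulrC; apply: ler_pM; rewrite ?sqr_ge0 ?expR_ge0.
have l5 : `|x| * expR `|x| * `|y| <= normc z ^+ 2 * expR (normc z).
  have : `|x| * `|y| <= normc z ^+ 2 by rewrite expr2; exact: ler_pM.
  by rewrite mulrAC => h; apply: ler_pM; rewrite ?mulr_ge0 ?expR_ge0.
have l6 : y ^+ 2 <= normc z ^+ 2 * expR (normc z).
  by rewrite (le_trans sy)// -[leLHS]mulr1 ler_wpM2l// sqr_ge0.
lra.
Qed.

End cexp.

(** * Correlations and the contraction property *)

(** The correlation of mu with E. With the kernel of the Carleman transform its
    value at 0 is the Carleman transform; the translates by s are needed because
    the arguments below compare its values at different points. *)
Definition correlation {R : realType} (mu : set R -> R[i]) (E : R -> R[i]) (s : R) : R[i] :=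
  radon_integral mu setT (fun t => E (t - s)).

(** Dominated convergence. *)
Lemma integral_tail {R : realType} (q : {measure set R -> \bar R}) (f : R -> R) (eps : R) :
  q.-integrable setT (EFin \o f) -> (forall x, 0 <= f x) -> 0 < eps ->
  exists2 n : nat, (0 < n)%N &
    Rintegral q setT (fun x => if `|x| <= n%:R then 0 else f x) <= eps.
Proof.
move=> intf f0 e0.
have mf : measurable_fun setT f by apply/measurable_EFinP; exact: measurable_int intf.
pose g (n : nat) (x : R) := if `|x| <= n%:R then 0 else f x.
have mg n : measurable_fun setT (g n).
  apply: measurable_fun_if => //; last exact: measurable_funTS.
  by apply: measurable_fun_ler => //; apply: measurableT_comp.
have gf n x : `|g n x| <= f x by rewrite /g; case: ifP => _; rewrite ?normr0 ?(ger0_norm (f0 x)).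
have h1 n : measurable_fun setT (fun x => (g n x)%:E) by apply/measurable_EFinP.
have h2 x : setT x -> (g n x)%:E @[n --> \oo] --> (cst 0%E x : \bar R).
  move=> _; apply: cvg_near_cst; near=> n; rewrite /g ifT//.
  apply: le_trans (ltW (archi_boundP (normr_ge0 x))) _.
  by rewrite ler_nat; near: n; exists (Num.bound `|x|).
have h3 (n : nat) (x : R) : setT x -> (`|(g n x)%:E| <= (EFin \o f) x)%E.
  by move=> _; rewrite lee_fin.
have := @dominated_cvg _ _ _ q setT measurableT _ _ (EFin \o f) h1 h2 (fun _ _ => isT) intf h3.
rewrite integral0 => /fine_cvgP[_ /cvgrPdist_le/(_ _ e0)[N _ HN]].
exists N.+1 => //; have := HN N.+1 (leqnSn _); rewrite /= sub0r normrN.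
exact: le_trans (ler_norm _).
Unshelve. all: by end_near. Qed.

Section correlation.
Context {R : realType} (mu : set R -> R[i]) (M : R).
Context (p : nat -> {sigma_finite_measure set R -> \bar R}).
Hypothesis hp : forall k, upper_variation (part mu k) = p k :> (set R -> \bar R).
Hypothesis hpM : forall k (a b : R), b - a <= 1 -> (p k `[a, b]%classic <= M%:E)%E.
Implicit Types E : R -> R[i].

Lemma correlationE E s : correlation mu E s =
  \sum_(k < 4) 'i ^+ k * cintegral (p k) setT (fun t => E (t - s)).
Proof. by rewrite /correlation radon_integral_part; apply: eq_bigr => k _; rewrite hp. Qed.

Lemma correlation_shift E s u : correlation mu E (s + u) = correlation mu (fun x => E (x - u)) s.
Proof. by rewrite /correlation; congr radon_integral; apply/funext => t; rewrite opprD addrA. Qed.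

Lemma correlationD E F s : exp_decay E -> exp_decay F ->
  correlation mu (fun x => E x + F x) s = correlation mu E s + correlation mu F s.
Proof.
move=> hE hF; rewrite !correlationE -big_split; apply: eq_bigr => k _ /=.
by rewrite -mulrDr cintegralD//; exact: (exp_decay_integrable (hpM k)).
Qed.

Lemma correlationZ c E s : exp_decay E ->
  correlation mu (fun x => c * E x) s = c * correlation mu E s.
Proof.
move=> hE; rewrite !correlationE mulr_sumr; apply: eq_bigr => k _ /=.
by rewrite cintegralZ ?mulrA ?[c * _]mulrC//; exact: (exp_decay_integrable (hpM k)).
Qed.

Lemma correlation_bound E A c s : cmeasurable E -> 0 < c ->
  (forall x, normc (E x) <= A * expR (- c * `|x|)) ->
  normc (correlation mu E s) <= 16 * M * (1 + c^-1) * A.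
Proof.
move=> mE c0 EA; rewrite correlationE; apply: le_trans (ler_normc_sum _ _ _) _.
apply: (@le_trans _ _ (\sum_(k < 4) 4 * M * (1 + c^-1) * A)).
  apply: ler_sum => k _; rewrite Normc.normcM normcX normc_i expr1n mul1r.
  exact: (exp_decay_bound (hpM k)).
by rewrite sumr_const card_ord -mulr_natl; lra.
Qed.

Lemma correlation_bounded E : exp_decay E -> exists S, forall s, normc (correlation mu E s) <= S.
Proof.
move=> [mE [A [c [c0 EA]]]]; exists (16 * M * (1 + c^-1) * A) => s.
exact: correlation_bound.
Qed.

Context (L : {sigma_finite_measure set R -> \bar R}) (K : R -> R[i]).
Hypothesis hL : forall (a : R) (A : set R), measurable A ->
  L ((fun x => a - x) @^-1` A) = L A.
Hypothesis hK : cintegrable L setT K.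
Hypothesis hpK : forall k u, cintegrable (p k) setT (fun t => K (t - u)).
Hypothesis hzero : forall u : R, radon_integral mu setT (fun t => K (t - u)) = 0.

(** Exchanging the two integrations turns this into an integral of E against the
    correlations of mu with the translates of K, which vanish. *)
Lemma correlation_orthogonal E s : exp_decay E ->
  cintegrable L setT (fun x => K x * correlation mu E (s + x)) /\
  cintegral L setT (fun x => K x * correlation mu E (s + x)) = 0.
Proof.
move=> hE; have sw (k : nat) := correlation_swap hL (hpM k) s hK hE (hpK k).
pose F k x := 'i ^+ k * (K x * cintegral (p k) setT (fun t => E (t - (s + x)))).
pose G k x := 'i ^+ k * (E x * cintegral (p k) setT (fun t => K (t - (s + x)))).
have iF k : cintegrable L setT (F k) by apply: cintegrableZ => //; have [] := sw k.
have iG k : cintegrable L setT (G k) by apply: cintegrableZ => //; have [] := sw k.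
have -> : (fun x => K x * correlation mu E (s + x)) = (fun x => \sum_(k < 4) F k x).
  apply/funext => x; rewrite correlationE mulr_sumr; apply: eq_bigr => k _.
  by rewrite mulrCA.
split; first exact: (cintegrable_sum measurableT 4 iF).
rewrite (cintegral_sum measurableT 4 iF).
have -> : \sum_(k < 4) cintegral L setT (F k) = \sum_(k < 4) cintegral L setT (G k).
  by apply: eq_bigr => k _; have [i1 i2 e12] := sw k;
     rewrite (cintegralZ measurableT _ i1) (cintegralZ measurableT _ i2) e12.
rewrite -(cintegral_sum measurableT 4 iG) -[RHS](cintegral0 L setT).
congr cintegral; apply/funext => x.
transitivity (E x * radon_integral mu setT (fun t => K (t - (s + x)))); last by rewrite hzero mulr0.
rewrite radon_integral_part mulr_sumr.
apply: eq_bigr => k _; rewrite hp /G; move: (cintegral _ _ _) => c.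
by rewrite mulrCA.
Qed.

(** Near z0 a correlation is bounded by its twisted increments over a fixed range,
    with constants that do not depend on the kernel. In the language of translation
    groups, the generator has no approximate eigenvector of frequency close to z0. *)
Definition contracting (z0 : R[i]) : Prop := exists T d C : R,
  [/\ 0 < T, 0 < d, 0 <= C & forall z E B, normc (z - z0) < d -> exp_decay E ->
   (forall s u, `|u| <= T ->
     normc (cexp ('i * u%:C * z) * correlation mu E (s + u) - correlation mu E s) <= B) ->
   forall s, normc (correlation mu E s) <= C * B].

(** Any bound of f improves itself; applied to the supremum. *)
Lemma half_bound (f : R -> R[i]) (S B : R) : (forall s, normc (f s) <= S) ->
  (forall S', (forall s, normc (f s) <= S') -> forall s, normc (f s) <= S' / 2 + B) ->
  forall s, normc (f s) <= 2 * B.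
Proof.
move=> fS H s; pose X := range (fun s => normc (f s)).
have X0 : X !=set0 by exists (normc (f 0)); exists 0.
have hX : has_sup X by split => //; exists S => _ [t _ <-].
have fX t : normc (f t) <= sup X by apply: sup_upper_bound => //; exists t.
have : sup X <= sup X / 2 + B.
  by apply: ge_sup => // _ [t _ <-]; exact: H.
have := fX s; lra.
Qed.

(** Off the real line the twisting factor has modulus at most 1/2 after a suitable
    translation, and the correlation is at most half its supremum plus its
    increment. *)
Lemma contracting_nonreal z0 : complex.Im z0 != 0 -> contracting z0.
Proof.
move=> y0; have ay0 : 0 < `|complex.Im z0| by rewrite normr_gt0.
exists (2 / `|complex.Im z0|), (`|complex.Im z0| / 2), 2.
split; [by rewrite divr_gt0|by rewrite divr_gt0|by []|] => z E B zz0 hE H.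
have [S hS] := correlation_bounded hE; apply: (half_bound hS) => S' hS' s.
(* u has the sign of Im z, so that translating by u multiplies by a factor of
   modulus at most e^(-1) *)
pose u := 2 / complex.Im z0.
have uT : `|u| <= 2 / `|complex.Im z0| by rewrite /u normrM normfV ger0_norm.
have hIm : `|complex.Im z - complex.Im z0| < `|complex.Im z0| / 2.
  by apply: le_lt_trans zz0; rewrite -ImN -ImD normc_Im.
have e2 : normc (cexp ('i * u%:C * z)) <= 2^-1.
  rewrite normc_cexp !ReM !ImM /=.
  have h1 : 1 <= u * complex.Im z.
    have hu : u * complex.Im z0 = 2 by rewrite /u divfK.
    have : `|u * (complex.Im z - complex.Im z0)| <= 1.
      rewrite normrM; apply: le_trans (ler_pM _ _ uT (ltW hIm)) _ => //.
      by rewrite mulrA divfK ?gt_eqF// divff.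
    by rewrite ler_norml mulrBr hu => /andP[]; lra.
  have : expR (- 1) <= 2^-1 :> R.
    rewrite expRN lef_pV2 ?posrE ?expR_gt0//.
    by have := expR_ge1Dx (1 : R); lra.
  by apply: le_trans; rewrite ler_expR; lra.
have := H s u uT; set a := correlation mu E (s + u); set b := correlation mu E s => hB.
have -> : b = cexp ('i * u%:C * z) * a - (cexp ('i * u%:C * z) * a - b) by rewrite subKr.
apply: le_trans (ler_normcB _ _) _; rewrite Normc.normcM; apply: lerD => //.
  have := ler_pM (normc_ge0 _) (normc_ge0 a) e2 (hS' (s + u)); lra.
Qed.

(** This is the only place where the equation and the Fourier transform of K enter.
    If the twisted increments of f are small, f (s + t) is close to e^(-itl) f s
    for |t| <= T, and integrating against K gives almost the Fourier transform of
    K at l times f s. The integral being 0, f s is small. This replaces a local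
    inversion of the Fourier transform of K in the Wiener algebra. *)
Lemma contracting_fourier (l : R) :
  cintegral L setT (fun t => K t * cexp (- ('i * l%:C * t%:C))) != 0 -> contracting l%:C.
Proof.
set Kl := cintegral _ _ _ => Kl0.
pose kap := normc Kl.
have kap0 : 0 < kap.
  by rewrite lt_neqAle normc_ge0 andbT eq_sym; apply: contra_neq Kl0; exact: Normc.eq0_normc.
pose k1 (t : R) := `|complex.Re (K t)| + `|complex.Im (K t)|.
have k1_ge0 t : 0 <= k1 t by rewrite addr_ge0.
have ik1 : L.-integrable setT (EFin \o k1).
  have [i1 i2] := hK; exact: (integrableD measurableT (integrable_norm i1) (integrable_norm i2)).
have mk1 : measurable_fun setT k1 by apply/measurable_EFinP; exact: measurable_int ik1.
pose N := Rintegral L setT k1.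
have N0 : 0 <= N by apply: Rintegral_ge0 => t _; exact: k1_ge0.
(* T makes the mass of K outside [-T, T] small with respect to kap, and d makes
   the phases e^(-itz) and e^(-itl) close to each other on [-T, T] *)
have [n n0 tail] := integral_tail ik1 k1_ge0 (divr_gt0 kap0 (ltr0n R 16 : 0 < 16%:R)).
pose T : R := n%:R; have T0 : 0 < T by rewrite ltr0n.
have T0' : 0 <= T by exact: ltW.
set tl := Rintegral _ _ _ in tail.
pose a := 3 * T * expR T * N.
have a0 : 0 <= a by rewrite !mulr_ge0 ?expR_ge0.
pose d := Num.min 1 (kap / (16 * (a + 1))).
have d0 : 0 < d by rewrite lt_min ltr01 divr_gt0// mulr_gt0// ltr_wpDl.
exists T, d, (2 * (2 * N * expR T / kap)); split => //.
  by rewrite !mulr_ge0 ?invr_ge0 ?expR_ge0 ?(ltW kap0).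
move=> z E B zl hE H.
have B0 : 0 <= B.
  by apply: le_trans (H 0 0 _); rewrite ?normc_ge0// normr0 ltW.
have [S hS] := correlation_bounded hE.
move=> s0; rewrite -[leRHS]mulrA; move: s0; apply: (half_bound hS) => S' hS' s.
have S'0 : 0 <= S' by rewrite (le_trans (normc_ge0 _) (hS' 0)).
set f := correlation mu E in hS' *.
pose el (t : R) := cexp (- ('i * l%:C * t%:C)).
have d1 : d <= 1 by rewrite ge_min lexx.
have pointwise t : `|t| <= T ->
    normc (el t * f s - f (s + t)) <= expR T * B + 3 * T * d * expR T * S'.
  move=> tT.
  have nz : normc (- ('i * t%:C * (z - l%:C))) <= T * d.
    rewrite normcN !Normc.normcM normc_i mul1r normcR.
    by apply: ler_pM => //; [exact: normc_ge0|exact: ltW].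
  have Td : T * d <= T by rewrite ler_piMr// ltW.
  have e1 : normc (cexp (- ('i * t%:C * z))) <= expR T.
    rewrite normc_cexp ler_expR ReN !ReM !ImM /=.
    have : `|complex.Im (z - l%:C)| <= d by rewrite (le_trans (normc_Im _))// ltW.
    rewrite ImD /= subr0 => hIm.
    have : `|t * complex.Im z| <= T * d by rewrite normrM; apply: ler_pM.
    by rewrite ler_norml => /andP[]; lra.
  have e2 : normc (el t - cexp (- ('i * t%:C * z))) <= 3 * T * d * expR T.
    have -> : cexp (- ('i * t%:C * z)) = el t * cexp (- ('i * t%:C * (z - l%:C))).
      by rewrite /el -cexpD; congr cexp; ring.
    rewrite -{1}[el t]mulr1 -mulrBr Normc.normcM normc_cexp.
    have -> : complex.Re (- ('i * l%:C * t%:C)) = 0 by rewrite ReN !ReM !ImM /=; lra.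
    rewrite expR0 mul1r normcB; apply: le_trans (cexpB1_le _) _.
    rewrite -[3 * T * d]mulrA; apply: ler_pM; rewrite ?expR_ge0 ?mulr_ge0 ?normc_ge0//.
      by rewrite ler_wpM2l.
    by rewrite ler_expR (le_trans nz).
  have -> : el t * f s - f (s + t) = (el t - cexp (- ('i * t%:C * z))) * f s
     - cexp (- ('i * t%:C * z)) * (cexp ('i * t%:C * z) * f (s + t) - f s).
    have E1 : cexp (- ('i * t%:C * z)) * cexp ('i * t%:C * z) = 1.
      by rewrite -cexpD addNr cexp0.
    by rewrite [cexp (- _) * (_ - _)]mulrBr [cexp _ * (cexp _ * _)]mulrA E1 mul1r; ring.
  apply: le_trans (ler_normcB _ _) _; rewrite !Normc.normcM addrC; apply: lerD.
    by apply: ler_pM; rewrite ?normc_ge0 ?H.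
  by apply: ler_pM; rewrite ?normc_ge0 ?hS'.
have [ic c0] := correlation_orthogonal s hE; rewrite -/f in ic c0.
have iK : cintegrable L setT (fun t => K t * el t).
  apply: (cintegrable_le measurableT (g := k1)) => //.
    apply: cmeasurableM; first by split; apply/measurable_EFinP; [exact: measurable_int hK.1|exact: measurable_int hK.2].
    have E1 t : el t = cos (l * t) +i* - sin (l * t).
      rewrite /el /cexp ReN ImN !ReM !ImM /=.
      have -> : - ((0 * l - 1 * 0) * t - (0 * 0 + 1 * l) * 0) = 0 by ring.
      have -> : - ((0 * l - 1 * 0) * 0 + (0 * 0 + 1 * l) * t) = - (l * t) by ring.
      by rewrite expR0 !mul1r cosN sinN.
    rewrite (funext E1); split => /=.
      apply: (@measurableT_comp _ _ _ _ _ _ (@cos R)); last exact: measurable_funM.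
      by apply: continuous_measurable_fun; exact: continuous_cos.
    apply: measurableT_comp => //.
    apply: (@measurableT_comp _ _ _ _ _ _ (@sin R)); last exact: measurable_funM.
    by apply: continuous_measurable_fun; exact: continuous_sin.
  move=> t _; rewrite Normc.normcM normc_cexp.
  have -> : complex.Re (- ('i * l%:C * t%:C)) = 0 by rewrite ReN !ReM !ImM /=; lra.
  by rewrite expR0 mulr1 normc_le.
have ifs : cintegrable L setT (fun t => f s * (K t * el t)) by exact: cintegrableZ.
have iN : cintegrable L setT (fun t => (-1) * (K t * f (s + t))) by exact: cintegrableZ.
(* the transform of K at l times f s, since K is orthogonal to the translates
   of f *)
have main : Kl * f s = cintegral L setT (fun t => f s * (K t * el t) + (-1) * (K t * f (s + t))).
  by rewrite cintegralD// !cintegralZ// c0 mulr0 addr0 mulrC.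
pose c1 : R := expR T * B + 3 * T * d * expR T * S'.
pose bd := fun t : R => k1 t * c1 + (if `|t| <= T then 0 else k1 t) * (2 * S').
have itail : L.-integrable setT (fun t => (if `|t| <= T then 0 else k1 t)%:E).
  apply: (le_integrable measurableT _ _ ik1) => [|t _].
    apply/measurable_EFinP; apply: measurable_fun_if => //; last exact: measurable_funTS.
    by apply: measurable_fun_ler => //; apply: measurableT_comp.
  by case: ifP => _ //; rewrite lee_fin normr0.
have j1 := integrableZr measurableT c1 ik1; have j2 := integrableZr measurableT (2 * S') itail.
have ig : L.-integrable setT (fun t => (bd t)%:E) := integrableD measurableT j1 j2.
have bound : kap * normc (f s) <= 2 * (N * c1 + tl * (2 * S')).
  rewrite -Normc.normcM main.
  have -> : N * c1 + tl * (2 * S') = Rintegral L setT bd.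
    by rewrite (RintegralD measurableT j1 j2) (RintegralZr _ measurableT ik1) (RintegralZr _ measurableT itail).
  apply: (normc_cintegral_le measurableT) => //; first exact: cintegrableD.
  move=> t _; have -> : f s * (K t * el t) + (-1) * (K t * f (s + t)) = K t * (el t * f s - f (s + t)) by ring.
  rewrite Normc.normcM /bd; case: ifPn => tT.
    by rewrite mul0r addr0; apply: ler_pM; rewrite ?normc_ge0 ?normc_le ?pointwise.
  have h1 : normc (el t * f s - f (s + t)) <= 2 * S'.
    rewrite (le_trans (ler_normcB _ _))// Normc.normcM normc_cexp.
    have -> : complex.Re (- ('i * l%:C * t%:C)) = 0 by rewrite ReN !ReM !ImM /=; lra.
    by rewrite expR0 mul1r; have := hS' s; have := hS' (s + t); lra.
  apply: (@le_trans _ _ (k1 t * (2 * S'))).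
    by apply: ler_pM; rewrite ?normc_ge0 ?normc_le.
  by rewrite lerDr mulr_ge0// addr_ge0// !mulr_ge0 ?expR_ge0// ltW.
have d2 : d * a <= kap / 16.
  have : d <= kap / (16 * (a + 1)) by rewrite ge_min lexx orbT.
  rewrite ler_pdivlMr ?mulr_gt0 ?ltr_wpDl// => h.
  by have := d0; lra.
have -> : S' / 2 + 2 * N * expR T / kap * B = (kap / 2 * S' + 2 * N * expR T * B) / kap.
  by field; rewrite gt_eqF.
rewrite ler_pdivlMr// mulrC; apply: (le_trans bound); rewrite /c1.
have := ler_wpM2r S'0 d2; have := ler_wpM2r S'0 tail; have := mulr_ge0 (ltW kap0) S'0.
by rewrite /a; lra.
Qed.

End correlation.

(** * The kernel of the Carleman transform *)

Section exp_decay_closure.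
Context {R : realType}.
Implicit Types E F : R -> R[i].

Lemma exp_decay_ge0 E A c : (forall x, normc (E x) <= A * expR (- c * `|x|)) -> 0 <= A.
Proof. by move=> h; have := le_trans (normc_ge0 _) (h 0); rewrite pmulr_lge0// expR_gt0. Qed.

Lemma exp_decayD E F : exp_decay E -> exp_decay F -> exp_decay (fun x => E x + F x).
Proof.
move=> [mE [A [c [c0 EA]]]] [mF [B [d [d0 FB]]]]; split; first exact: cmeasurableD.
exists (A + B), (Num.min c d); split; first by rewrite lt_min c0.
move=> x; rewrite mulrDl (le_trans (ler_normcD _ _))//; apply: lerD.
  apply: le_trans (EA x) _; apply: ler_wpM2l; first exact: exp_decay_ge0 EA.
  by rewrite ler_expR ler_wpM2r// lerN2 ge_min lexx.
apply: le_trans (FB x) _; apply: ler_wpM2l; first exact: exp_decay_ge0 FB.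
by rewrite ler_expR ler_wpM2r// lerN2 ge_min lexx orbT.
Qed.

Lemma exp_decayZ a E : exp_decay E -> exp_decay (fun x => a * E x).
Proof.
move=> [mE [A [c [c0 EA]]]]; split; first exact: cmeasurableZ.
exists (normc a * A), c; split => // x; rewrite Normc.normcM -mulrA.
by apply: ler_wpM2l => //; exact: normc_ge0.
Qed.

Lemma exp_decay_shift E u : exp_decay E -> exp_decay (fun x => E (x - u)).
Proof.
move=> [mE [A [c [c0 EA]]]]; split; first exact: cmeasurable_shift.
exists (A * expR (c * `|u|)), c; split => // x; apply: le_trans (EA _) _.
rewrite -mulrA -expRD; apply: ler_wpM2l; first exact: exp_decay_ge0 EA.
rewrite ler_expR; have : `|x| <= `|x - u| + `|u| by rewrite -[x in `|x|](subrK u) ler_normD.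
by move=> /(ler_wpM2l (ltW c0)); lra.
Qed.

End exp_decay_closure.

Section kernels.
Context {R : realType}.
Implicit Types (z w : R[i]) (x u : R).

(** The value 1/2 at 0 encodes the halved atom of the Carleman transform. *)
Definition heaviside x : R := if 0 < x then 1 else if x == 0 then 2^-1 else 0.

Definition wave z x : R[i] := cexp ('i * x%:C * z).

(** For both half-planes at once: the kernel is e^(ixz) times the Heaviside function
    above the real line and times the Heaviside function minus 1 below it, so that
    it decays in both cases and jumps by 1 at 0. *)
Definition ckernel z x : R[i] :=
  wave z x * (if 0 < complex.Im z then heaviside x else heaviside x - 1)%:C.

Definition ckernel_deriv z x : R[i] := 'i * x%:C * ckernel z x.

Definition jump u x : R[i] := (heaviside (x - u) - heaviside x)%:C.

Lemma waveD z x u : wave z (x + u) = wave z x * wave z u.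
Proof. by rewrite /wave -cexpD rmorphD /=; congr cexp; ring. Qed.

Lemma waveB z w x : wave z x = wave w x * wave (z - w) x.
Proof. by rewrite /wave -cexpD; congr cexp; ring. Qed.

Lemma normc_wave z x : normc (wave z x) = expR (- (x * complex.Im z)).
Proof. by rewrite normc_cexp !ReM !ImM /=; congr expR; ring. Qed.

Lemma cmeasurable_wave z : cmeasurable (wave z).
Proof.
have mre : measurable_fun setT (fun x : R => expR (complex.Re ('i * x%:C * z))).
  apply: measurableT_comp => //.
  have E x : complex.Re ('i * x%:C * z) = - (x * complex.Im z) by rewrite !ReM !ImM /=; ring.
  by under eq_fun do rewrite E; apply: measurableT_comp => //; exact: measurable_funM.
have mim : measurable_fun setT (fun x : R => complex.Im ('i * x%:C * z)).
  have E x : complex.Im ('i * x%:C * z) = x * complex.Re z by rewrite ImM !ReM !ImM /=; ring.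
  by under eq_fun do rewrite E; exact: measurable_funM.
split; rewrite /wave /cexp /=; apply: measurable_funM => //.
  apply: (@measurableT_comp _ _ _ _ _ _ (@cos R)) => //.
  by apply: continuous_measurable_fun; exact: continuous_cos.
apply: (@measurableT_comp _ _ _ _ _ _ (@sin R)) => //.
by apply: continuous_measurable_fun; exact: continuous_sin.
Qed.

Lemma measurable_heaviside : measurable_fun setT heaviside.
Proof.
apply: measurable_fun_ifT => //; first by apply: measurable_fun_ltr.
by apply: measurable_fun_ifT => //; apply: measurable_fun_eqr.
Qed.

Lemma cmeasurable_real (f : R -> R) : measurable_fun setT f -> cmeasurable (fun x => (f x)%:C).
Proof. by move=> mf; split => //=; exact: measurable_cst. Qed.

Lemma heaviside_itv x : 0 <= heaviside x <= 1.
Proof. by rewrite /heaviside; case: ifP => _; [|case: ifP => _]; apply/andP; split; lra. Qed.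

Lemma cmeasurable_ckernel z : cmeasurable (ckernel z).
Proof.
apply: cmeasurableM; first exact: cmeasurable_wave.
apply: cmeasurable_real; case: (0 < complex.Im z); first exact: measurable_heaviside.
by apply: measurable_funB => //; exact: measurable_heaviside.
Qed.

Lemma normc_ckernel_le z x : normc (ckernel z x) <= expR (- `|complex.Im z| * `|x|).
Proof.
rewrite Normc.normcM normc_wave normcR; have /andP[t0 t1] := heaviside_itv x.
have [y0|y0] := ltP 0 (complex.Im z).
  rewrite (ger0_norm t0) (gtr0_norm y0).
  have [x0|x0] := leP 0 x.
    rewrite (ger0_norm x0) mulNr [x * _]mulrC; rewrite -[leRHS]mulr1.
    by apply: ler_wpM2l => //; exact: expR_ge0.
  by rewrite /heaviside (lt_gtF x0) (lt_eqF x0) mulr0 expR_ge0.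
rewrite (ler0_norm y0) ler0_norm ?subr_le0// opprB.
have [x0|x0] := ltP 0 x; first by rewrite /heaviside x0 subrr mulr0 expR_ge0.
rewrite (ler0_norm x0) opprK mulrN [x * _]mulrC -[leRHS]mulr1.
by apply: ler_wpM2l; [exact: expR_ge0|lra].
Qed.

Lemma exp_decay_ckernel z : complex.Im z != 0 -> exp_decay (ckernel z).
Proof.
move=> z0; split; first exact: cmeasurable_ckernel.
exists 1, `|complex.Im z|; split; first by rewrite normr_gt0.
by move=> x; rewrite mul1r; exact: normc_ckernel_le.
Qed.

(** Half of the exponential decay absorbs the factor |x|. *)
Lemma exp_decay_ckernel_deriv z : complex.Im z != 0 -> exp_decay (ckernel_deriv z).
Proof.
move=> z0; split.
  apply: cmeasurableM; last exact: cmeasurable_ckernel.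
  apply: cmeasurableZ; exact: cmeasurable_real.
have y0 : 0 < `|complex.Im z| by rewrite normr_gt0.
set y := `|_| in y0.
exists (2 / y), (y / 2); split; first by rewrite divr_gt0.
move=> x; rewrite !Normc.normcM normc_i mul1r normcR -Normc.normcM.
apply: le_trans (ler_wpM2l (normr_ge0 x) (normc_ckernel_le z x)) _.
have -> : - y * `|x| = - (y / 2) * `|x| + - (y / 2) * `|x| by field.
rewrite expRD mulrA; apply: ler_wpM2r; first exact: expR_ge0.
have := expR_ge1Dx (y / 2 * `|x|); rewrite [- (y / 2) * _]mulNr expRN.
set e := expR _ => he; have e0 : 0 < e by exact: expR_gt0.
rewrite ler_pdivrMr// mulrAC ler_pdivlMr//.
by have := normr_ge0 x; lra.
Qed.

(** The constant subtracted in the lower half-plane disappears, so the twisted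
    increment is given by the same compactly supported kernel, analytic in z, in
    both half-planes. *)
Lemma ckernel_increment z x u : wave z u * ckernel z (x - u) - ckernel z x = wave z x * jump u x.
Proof.
rewrite /ckernel /jump mulrA -waveD [u + _]addrC subrK -mulrBr -rmorphB /=.
by congr (_ * _%:C); case: ifP => _; ring.
Qed.

Lemma ckernel_deriv_increment z x u : wave z u * ckernel_deriv z (x - u) - ckernel_deriv z x =
  'i * x%:C * wave z x * jump u x - 'i * u%:C * wave z u * ckernel z (x - u).
Proof.
have := ckernel_increment z x u; rewrite /ckernel_deriv rmorphB /= => h.
rewrite -[_ * wave z x * _]mulrA -h; ring.
Qed.

(** The first-order Taylor remainder in z, as a linear combination of decaying
    kernels. The points z and w may lie in different half-planes. *)
Definition ckernel_taylor z w x : R[i] := ckernel z x + (-1) * ckernel w x + (- (z - w)) * ckernel_deriv w x.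

(** The twisted increment involves only Taylor remainders of exponentials, which
    are quadratic in z - w, and the kernels at w. *)
Lemma ckernel_taylor_increment z w x u : wave z u * ckernel_taylor z w (x - u) - ckernel_taylor z w x =
  wave w x * (wave (z - w) x - 1 - 'i * x%:C * (z - w)) * jump u x
  - (wave (z - w) u - 1 - 'i * u%:C * (z - w)) * wave w u * ckernel w (x - u)
  - (z - w) * (wave (z - w) u - 1) * wave w u * ckernel_deriv w (x - u).
Proof.
have h1 : ckernel z x = wave w u * wave (z - w) u * ckernel z (x - u) - wave w x * wave (z - w) x * jump u x.
  by rewrite -!waveB -ckernel_increment subKr.
have h2 : ckernel w x = wave w u * ckernel w (x - u) - wave w x * jump u x.
  by rewrite -ckernel_increment subKr.
have h3 : ckernel_deriv w x = wave w u * ckernel_deriv w (x - u) - 'i * x%:C * wave w x * jump u x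
    + 'i * u%:C * wave w u * ckernel w (x - u).
  by have := ckernel_deriv_increment w x u => /eqP; rewrite subr_eq => /eqP ->; ring.
rewrite /ckernel_taylor h1 h2 h3 [wave z u](waveB z w); ring.
Qed.

Lemma normc_jump_le1 u x : normc (jump u x) <= 1.
Proof.
have /andP[a0 a1] := heaviside_itv x; have /andP[b0 b1] := heaviside_itv (x - u).
by rewrite /jump normcR ler_norml; apply/andP; split; lra.
Qed.

Lemma jump_out u x : `|u| < `|x| -> jump u x = 0.
Proof.
move=> xu; suff E : heaviside (x - u) = heaviside x by rewrite /jump E subrr.
rewrite /heaviside; have [x0|x0|x0] := ltgtP x 0.
- rewrite (ltr0_norm x0) in xu; have := ler_norm (- u); rewrite normrN => un.
  have xu0 : x - u < 0 by lra.
  by rewrite (lt_gtF xu0) (lt_eqF xu0).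
- rewrite (gtr0_norm x0) in xu; have := ler_norm u => un.
  have xu0 : 0 < x - u by lra.
  by rewrite xu0.
- by move: xu; rewrite x0 normr0 ltNge normr_ge0.
Qed.

End kernels.

(** * Taylor estimate for the Carleman transform *)

Lemma normc_wave_le {R : realType} (z : R[i]) (x T D : R) : `|x| <= T -> normc z <= D ->
  normc (wave z x) <= expR (T * D).
Proof.
move=> xT zD; rewrite normc_wave ler_expR.
have h : `|x * complex.Im z| <= T * D.
  by rewrite normrM; apply: ler_pM => //; exact: le_trans (normc_Im _) zD.
by have := ler_norm (- (x * complex.Im z)); rewrite normrN; lra.
Qed.

Lemma normc_iM {R : realType} (x : R) (z : R[i]) : normc ('i * x%:C * z) = `|x| * normc z.
Proof. by rewrite !Normc.normcM normc_i mul1r normcR. Qed.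

Lemma normc_waveB1_le {R : realType} (z : R[i]) (x T D : R) : `|x| <= T -> normc z <= D ->
  normc (wave z x - 1) <= 3 * T * normc z * expR (T * D).
Proof.
move=> xT zD; apply: le_trans (cexpB1_le _) _; rewrite normc_iM -[3 * T * _]mulrA.
apply: ler_pM; rewrite ?mulr_ge0 ?normc_ge0 ?expR_ge0//.
  by rewrite ler_wpM2l// ler_wpM2r// normc_ge0.
by rewrite ler_expR; apply: ler_pM; rewrite ?normc_ge0.
Qed.

Lemma normc_waveB1z_le {R : realType} (z : R[i]) (x T D : R) : `|x| <= T -> normc z <= D ->
  normc (wave z x - 1 - 'i * x%:C * z) <= 4 * T ^+ 2 * normc z ^+ 2 * expR (T * D).
Proof.
move=> xT zD; apply: le_trans (cexpB1z_le _) _; rewrite normc_iM -[4 * T ^+ 2 * _]mulrA -exprMn.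
apply: ler_pM; rewrite ?mulr_ge0 ?exprn_ge0 ?mulr_ge0 ?normc_ge0 ?expR_ge0//.
  rewrite ler_wpM2l// lerXn2r ?nnegrE ?mulr_ge0 ?normc_ge0//; last by rewrite ler_wpM2r// normc_ge0.
  exact: le_trans xT.
by rewrite ler_expR; apply: ler_pM; rewrite ?normc_ge0.
Qed.

Section taylor.
Context {R : realType} (mu : set R -> R[i]) (M : R).
Context (p : nat -> {sigma_finite_measure set R -> \bar R}).
Hypothesis hp : forall k, upper_variation (part mu k) = p k :> (set R -> \bar R).
Hypothesis hpM : forall k (a b : R), b - a <= 1 -> (p k `[a, b]%classic <= M%:E)%E.
Implicit Types E : R -> R[i].

Lemma cmeasurable_jump u : cmeasurable (jump u : R -> R[i]).
Proof.
apply: cmeasurable_real; apply: measurable_funB; last exact: measurable_heaviside.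
by apply: (measurableT_comp measurable_heaviside); exact: measurable_funB.
Qed.

(** The jump is supported in [-T, T], where e^T e^(-|x|) is at least 1. *)
Lemma jump_kernel_le (m : R -> R[i]) u T Q : `|u| <= T ->
  (forall x, `|x| <= T -> normc (m x) <= Q) ->
  forall x, normc (m x * jump u x) <= Q * expR T * expR (- 1 * `|x|).
Proof.
move=> uT hm x; have Q0 : 0 <= Q.
  by apply: le_trans (hm 0 _); rewrite ?normc_ge0// normr0 (le_trans _ uT).
have [xT|xT] := leP `|x| T; last first.
  by rewrite jump_out ?(le_lt_trans uT)// mulr0 Normc.normc0 !mulr_ge0 ?expR_ge0.
rewrite Normc.normcM -mulrA -expRD; apply: ler_pM; rewrite ?normc_ge0 ?hm//.
by apply: le_trans (normc_jump_le1 _ _) _; rewrite -[leLHS]expR0 ler_expR; lra.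
Qed.

Lemma exp_decay_jump (m : R -> R[i]) u T Q : cmeasurable m -> `|u| <= T ->
  (forall x, `|x| <= T -> normc (m x) <= Q) -> exp_decay (fun x => m x * jump u x).
Proof.
move=> mm uT hm; split; first by apply: cmeasurableM => //; exact: cmeasurable_jump.
by exists (Q * expR T), 1; split => //; exact: jump_kernel_le.
Qed.

Lemma correlation_jump_le (m : R -> R[i]) u T Q s : cmeasurable m -> `|u| <= T ->
  (forall x, `|x| <= T -> normc (m x) <= Q) ->
  normc (correlation mu (fun x => m x * jump u x) s) <= 32 * M * expR T * Q.
Proof.
move=> mm uT hm.
have := correlation_bound hp hpM s _ ltr01 (jump_kernel_le uT hm).
rewrite invr1 => H; apply: le_trans (H _) _; last by lra.
by apply: cmeasurableM => //; exact: cmeasurable_jump.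
Qed.

Lemma correlation_increment c E s u : exp_decay E ->
  c * correlation mu E (s + u) - correlation mu E s =
  correlation mu (fun x => c * E (x - u) - E x) s.
Proof.
move=> hE; have hEu := exp_decay_shift u hE.
have -> : (fun x => c * E (x - u) - E x) = (fun x => c * E (x - u) + (-1) * E x).
  by apply/funext => x; rewrite mulN1r.
by rewrite (correlationD hp hpM) ?(correlationZ hp hpM) ?correlation_shift ?mulN1r//; exact: exp_decayZ.
Qed.

(** The correlations with the kernel, with its derivative and with its Taylor
    remainder are bounded one after the other, uniformly near z0 and regardless of
    the half-planes of z and w. The last bound is quadratic in z - w, and this is
    what makes the Carleman transform differentiable up to the real line. *)
Lemma correlation_taylor z0 : contracting mu z0 -> exists L d : R, [/\ 0 < d, 0 <= L &
  forall z w, normc (z - z0) < d -> normc (w - z0) < d ->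
    complex.Im z != 0 -> complex.Im w != 0 ->
    normc (correlation mu (ckernel z) 0 - correlation mu (ckernel w) 0 - (z - w) * correlation mu (ckernel_deriv w) 0)
    <= L * normc (z - w) ^+ 2].
Proof.
move=> [T [d [C [T0 d0 C0 H]]]].
have T0' := ltW T0; have d0' := ltW d0.
have M0 : 0 <= M := unit_bound_ge0 (hpM 0).
pose D := normc z0 + d.
have DP z : normc (z - z0) < d -> normc z <= D.
  move=> zd; rewrite -[z in normc z](subrK z0) (le_trans (ler_normcD _ _))//.
  by rewrite /D addrC lerD2l ltW.
pose J := 32 * M * expR T.
have J0 : 0 <= J by rewrite !mulr_ge0 ?expR_ge0.
pose e1 := expR (T * D).
have e10 : 0 <= e1 by exact: expR_ge0.
have mI : cmeasurable (fun x : R => 'i * x%:C) by apply: cmeasurableZ; exact: cmeasurable_real.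
pose C1 := C * (J * e1).
have C10 : 0 <= C1 by rewrite !mulr_ge0.
(* the three bounds are obtained in turn: the increments of each kernel involve
   the correlations with the previous ones *)
have step1 w : normc (w - z0) < d -> complex.Im w != 0 ->
    forall s, normc (correlation mu (ckernel w) s) <= C1.
  move=> wd w0; have wD := DP w wd; apply: (H w) => //; first exact: exp_decay_ckernel.
  move=> s u uT; rewrite correlation_increment; last exact: exp_decay_ckernel.
  rewrite (funext (fun x => ckernel_increment w x u)).
  apply: correlation_jump_le uT _; first exact: cmeasurable_wave.
  by move=> x xT; exact: normc_wave_le.
pose C2 := C * (J * (T * e1) + T * e1 * C1).
have C20 : 0 <= C2 by rewrite mulr_ge0// addr_ge0// !mulr_ge0.
have step2 w : normc (w - z0) < d -> complex.Im w != 0 ->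
    forall s, normc (correlation mu (ckernel_deriv w) s) <= C2.
  move=> wd w0; have wD := DP w wd; apply: (H w) => //; first exact: exp_decay_ckernel_deriv.
  move=> s u uT; rewrite correlation_increment; last exact: exp_decay_ckernel_deriv.
  have bm x : `|x| <= T -> normc ('i * x%:C * wave w x) <= T * e1.
    move=> xT; rewrite normc_iM; apply: ler_pM; rewrite ?normc_ge0//.
    exact: normc_wave_le.
  have mm : cmeasurable (fun x => 'i * x%:C * wave w x).
    by apply: cmeasurableM => //; exact: cmeasurable_wave.
  have -> : (fun x => cexp ('i * u%:C * w) * ckernel_deriv w (x - u) - ckernel_deriv w x) =
      (fun x => 'i * x%:C * wave w x * jump u x + (- ('i * u%:C * wave w u)) * ckernel w (x - u)).
    by apply/funext => x; rewrite ckernel_deriv_increment mulNr.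
  have ke : exp_decay (fun x => ckernel w (x - u)) by apply: exp_decay_shift; exact: exp_decay_ckernel.
  rewrite (correlationD hp hpM); [|exact: exp_decay_jump uT bm|exact: exp_decayZ].
  rewrite (correlationZ hp hpM)// -correlation_shift.
  apply: le_trans (ler_normcD _ _) _; apply: lerD; first exact: correlation_jump_le uT bm.
  rewrite Normc.normcM normcN; apply: ler_pM; rewrite ?normc_ge0 ?bm//.
  exact: step1.
pose e2 := expR (T * (2 * d)).
have e20 : 0 <= e2 by exact: expR_ge0.
pose Q := 4 * T ^+ 2 * e2 * e1.
have Q0 : 0 <= Q by rewrite !mulr_ge0 ?exprn_ge0.
exists (C * (J * Q + Q * C1 + 3 * T * e2 * e1 * C2)), d; split => //.
  have h3 : 0 <= 3 * T * e2 * e1 by rewrite !mulr_ge0.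
  by apply: mulr_ge0 => //; apply: addr_ge0; [apply: addr_ge0|]; exact: mulr_ge0.
move=> z w zd wd zi wi; set X := normc (z - w).
have X0 : 0 <= X by exact: normc_ge0.
have Xd : normc (z - w) <= 2 * d.
  have -> : z - w = (z - z0) - (w - z0) by rewrite opprB addrA subrK.
  by rewrite (le_trans (ler_normcB _ _))//; lra.
have zD := DP z zd; have wD := DP w wd.
have kcz := exp_decay_ckernel zi; have kcw := exp_decay_ckernel wi; have kdw := exp_decay_ckernel_deriv wi.
have krk : exp_decay (ckernel_taylor z w) by apply: exp_decayD; [apply: exp_decayD => //|]; exact: exp_decayZ.
have rkE : correlation mu (ckernel_taylor z w) 0 =
   correlation mu (ckernel z) 0 - correlation mu (ckernel w) 0 - (z - w) * correlation mu (ckernel_deriv w) 0.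
  rewrite /ckernel_taylor (correlationD hp hpM); [|by apply: exp_decayD => //; exact: exp_decayZ|exact: exp_decayZ].
  rewrite (correlationD hp hpM)//; last exact: exp_decayZ.
  by rewrite !(correlationZ hp hpM)// mulN1r mulNr.
rewrite -rkE -mulrA; apply: (H z) => // s u uT.
rewrite correlation_increment//.
have b1 x : `|x| <= T -> normc (wave w x * (wave (z - w) x - 1 - 'i * x%:C * (z - w))) <= Q * X ^+ 2.
  move=> xT; rewrite Normc.normcM.
  have := ler_pM (normc_ge0 _) (normc_ge0 _) (normc_wave_le xT wD) (normc_waveB1z_le xT Xd).
  by rewrite -/X -/e1 -/e2 => h; apply: le_trans h _; rewrite /Q; lra.
have b2 : normc ((wave (z - w) u - 1 - 'i * u%:C * (z - w)) * wave w u) <= Q * X ^+ 2.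
  by rewrite mulrC b1.
have b3 : normc ((z - w) * (wave (z - w) u - 1) * wave w u) <= 3 * T * e2 * e1 * X ^+ 2.
  rewrite Normc.normcM [normc (_ * (_ - 1))]Normc.normcM.
  have := ler_pM (normc_ge0 _) (normc_ge0 _) (normc_waveB1_le uT Xd) (normc_wave_le uT wD).
  by rewrite -/X -/e1 -/e2 => /(ler_wpM2l X0) h; rewrite -mulrA (le_trans h)//; lra.
have m1 : cmeasurable (fun x => wave w x * (wave (z - w) x - 1 - 'i * x%:C * (z - w))).
  apply: cmeasurableM; first exact: cmeasurable_wave.
  have E x : wave (z - w) x - 1 - 'i * x%:C * (z - w) =
      wave (z - w) x + (-1) * (1 + (z - w) * ('i * x%:C)) by ring.
  under eq_fun do rewrite E.
  apply: cmeasurableD; first exact: cmeasurable_wave.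
  apply: cmeasurableZ; apply: cmeasurableD; first exact: cmeasurable_cst.
  exact: cmeasurableZ.
have -> : (fun x => cexp ('i * u%:C * z) * ckernel_taylor z w (x - u) - ckernel_taylor z w x) =
   (fun x => wave w x * (wave (z - w) x - 1 - 'i * x%:C * (z - w)) * jump u x
     + (- ((wave (z - w) u - 1 - 'i * u%:C * (z - w)) * wave w u)) * ckernel w (x - u)
     + (- ((z - w) * (wave (z - w) u - 1) * wave w u)) * ckernel_deriv w (x - u)).
  by apply/funext => x; rewrite ckernel_taylor_increment !mulNr.
have ke1 : exp_decay (fun x => ckernel w (x - u)) by exact: exp_decay_shift.
have ke2 : exp_decay (fun x => ckernel_deriv w (x - u)) by exact: exp_decay_shift.
have kj := exp_decay_jump m1 uT b1.
rewrite (correlationD hp hpM); [|by apply: exp_decayD => //; exact: exp_decayZ|exact: exp_decayZ].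
rewrite (correlationD hp hpM)//; last exact: exp_decayZ.
rewrite !(correlationZ hp hpM)// -!correlation_shift.
have -> : (J * Q + Q * C1 + 3 * T * e2 * e1 * C2) * X ^+ 2 =
  J * (Q * X ^+ 2) + Q * X ^+ 2 * C1 + 3 * T * e2 * e1 * X ^+ 2 * C2 by ring.
apply: le_trans (ler_normcD _ _) _; apply: lerD; last first.
  rewrite Normc.normcM normcN; apply: ler_pM; rewrite ?normc_ge0//.
  exact: step2.
apply: le_trans (ler_normcD _ _) _; apply: lerD; first exact: correlation_jump_le uT b1.
rewrite Normc.normcM normcN; apply: ler_pM; rewrite ?normc_ge0//.
exact: step1.
Qed.

End taylor.

(** * Extension across real points *)

Section extension.
Context {R : realType}.
Implicit Types (z w l : R[i]) (f k : R[i] -> R[i]).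

Lemma nonreal_near z (e : R) : 0 < e -> exists w, complex.Im w != 0 /\ normc (w - z) < e.
Proof.
move=> e0; have [z0|z0] := eqVneq (complex.Im z) 0; last first.
  by exists z; split => //; rewrite subrr Normc.normc0.
exists (z + 'i * (e / 2)%:C); split.
  by rewrite ImD ImM /= z0 mul0r !add0r mul1r gt_eqF// divr_gt0.
rewrite addrAC subrr add0r Normc.normcM normc_i mul1r normcR ger0_norm; lra.
Qed.

Lemma le_near_nonreal z (X Y C d : R) : 0 < d ->
  (forall w, complex.Im w != 0 -> normc (w - z) < d -> X <= Y + C * normc (w - z)) -> X <= Y.
Proof.
move=> d0 H; apply/ler_addgt0Pr => e e0.
have D0 : 0 < Num.min d (e / (`|C| + 1)) by rewrite lt_min d0 divr_gt0// ltr_wpDl.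
have [w [w0]] := nonreal_near z D0; rewrite lt_min => /andP[wd we].
apply: le_trans (H w w0 wd) _; rewrite lerD2l.
move: we; rewrite ltr_pdivlMr ?ltr_wpDl// => we.
have := ler_wpM2r (normc_ge0 (w - z)) (ler_norm C); have := normc_ge0 (w - z); lra.
Qed.

(** The supremum of u w - C |w - z|, as in the McShane extension of Lipschitz
    functions. It produces limits without Cauchy sequences. *)
Lemma mcshane_limit (S : set R[i]) (u : R[i] -> R) (z : R[i]) (C : R) : S !=set0 ->
  (forall w w', S w -> S w' -> `|u w - u w'| <= C * (normc (w - z) + normc (w' - z))) ->
  exists a, forall w, S w -> `|u w - a| <= C * normc (w - z).
Proof.
move=> [w0 Sw0] H; pose X := [set u w - C * normc (w - z) | w in S].
have key w w' : S w -> S w' -> u w - C * normc (w - z) <= u w' + C * normc (w' - z).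
  by move=> Sw Sw'; have := H w w' Sw Sw'; rewrite ler_norml => /andP[]; lra.
have hX : has_sup X.
  split; first by exists (u w0 - C * normc (w0 - z)); exists w0.
  by exists (u w0 + C * normc (w0 - z)) => _ [w Sw <-]; exact: key.
exists (sup X) => w Sw; rewrite ler_norml; apply/andP; split.
  have : sup X <= u w + C * normc (w - z); last by lra.
  by apply: ge_sup; [case: hX|move=> _ [w' Sw' <-]; exact: key].
have : u w - C * normc (w - z) <= sup X by apply: sup_upper_bound => //; exists w.
lra.
Qed.

(** The linear rate comes from Lipschitz bounds; it is what allows the Taylor
    estimate to be passed to the limit with an explicit error. *)
Definition nonreal_limit f z l := exists C d : R, 0 < d /\
  forall w, complex.Im w != 0 -> normc (w - z) < d -> normc (f w - l) <= C * normc (w - z).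

Lemma lipschitz_nonreal_limit f z (C d : R) : 0 < d -> 0 <= C ->
  (forall w w', complex.Im w != 0 -> complex.Im w' != 0 ->
    normc (w - z) < d -> normc (w' - z) < d -> normc (f w - f w') <= C * normc (w - w')) ->
  exists l, nonreal_limit f z l.
Proof.
move=> d0 C0 H; pose S := [set w | complex.Im w != 0 /\ normc (w - z) < d].
have S0 : S !=set0 by have [w wP] := nonreal_near z d0; exists w.
have H' w w' : S w -> S w' -> normc (f w - f w') <= C * (normc (w - z) + normc (w' - z)).
  move=> [w0 wd] [w0' wd']; apply: le_trans (H w w' w0 w0' wd wd') _.
  apply: ler_wpM2l => //; have -> : w - w' = (w - z) - (w' - z) by rewrite opprB addrA subrK.
  exact: ler_normcB.
have hRe w w' : S w -> S w' ->
    `|complex.Re (f w) - complex.Re (f w')| <= C * (normc (w - z) + normc (w' - z)).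
  by move=> Sw Sw'; apply: le_trans (H' w w' Sw Sw'); rewrite -ReN -ReD; exact: normc_Re.
have hIm w w' : S w -> S w' ->
    `|complex.Im (f w) - complex.Im (f w')| <= C * (normc (w - z) + normc (w' - z)).
  by move=> Sw Sw'; apply: le_trans (H' w w' Sw Sw'); rewrite -ImN -ImD; exact: normc_Im.
have [a ha] := mcshane_limit (u := fun w => complex.Re (f w)) S0 hRe.
have [b hb] := mcshane_limit (u := fun w => complex.Im (f w)) S0 hIm.
exists (a +i* b), (2 * C), d; split => // w w0 wd.
apply: le_trans (normc_le _) _; rewrite ReD ImD ReN ImN /=.
by have := ha w (conj w0 wd); have := hb w (conj w0 wd); lra.
Qed.

Lemma normc_tri z w v : normc (z - w) <= normc (z - v) + normc (v - w).
Proof.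
have -> : z - w = (z - v) + (v - w) by rewrite addrA subrK.
exact: ler_normcD.
Qed.

Lemma derivable_taylor (F : R[i] -> R[i]) z0 (kap : R[i]) (L d : R) : 0 < d -> 0 <= L ->
  (forall z, normc (z - z0) < d ->
     normc (F z - F z0 - (z - z0) * kap) <= L * normc (z - z0) ^+ 2) ->
  derivable (F : R[i]^o -> R[i]^o) z0 1.
Proof.
move=> d0 L0 H; apply/cvg_ex; exists (kap : R[i]^o).
apply/cvgrPdist_le => -[e e'] /=; rewrite ltcE /= => /andP[/eqP -> e0].
have D0 : 0 < Num.min d (e / (L + 1)) by rewrite lt_min d0 divr_gt0// ltr_wpDl.
apply/nbhs_ballP; exists (Num.min d (e / (L + 1)))%:C; first by rewrite /= ltcR.
move=> h; rewrite /ball /= sub0r normrN normr_normc ltcR lt_min => /andP[hd he] h0.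
rewrite normr_normc -/(e%:C) lecR.
have hn : 0 < normc h.
  rewrite lt_neqAle normc_ge0 andbT eq_sym; apply: contra_neq h0; exact: Normc.eq0_normc.
have hE : (h *: (1 : R[i]^o) + z0 : R[i]) - z0 = h by rewrite addrK; exact: mulr1.
have := H (h *: (1 : R[i]^o) + z0); rewrite hE => /(_ hd) Hh.
have -> : kap - h^-1 *: ((F (h *: (1 : R[i]^o) + z0) : R[i]^o) - F z0) =
   - (h^-1 * (F (h *: (1 : R[i]^o) + z0) - F z0 - h * kap)).
  rewrite mulrBr mulrA mulVf// mul1r opprB; congr (_ - _).
rewrite normcN Normc.normcM Normc.normcV mulrC ler_pdivrMr//.
apply: (le_trans Hh); rewrite expr2 mulrA; apply: ler_wpM2r; first exact: ltW.
move: he; rewrite ltr_pdivlMr ?ltr_wpDl// => he; lra.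
Qed.

(** The Taylor estimate makes k, then f, Lipschitz near each point of U, so both have
    limits at real points, and the estimate survives in the limit: the limit of k is
    the derivative of the extension. *)
Lemma taylor_extension f k (U : set R[i]) :
  (forall z0, U z0 -> exists L d : R, [/\ 0 < d, 0 <= L & forall z w,
     normc (z - z0) < d -> normc (w - z0) < d -> complex.Im z != 0 -> complex.Im w != 0 ->
     normc (f z - f w - (z - w) * k w) <= L * normc (z - w) ^+ 2]) ->
  exists F : R[i] -> R[i],
    (forall z, U z -> derivable (F : R[i]^o -> R[i]^o) z 1) /\
    (forall z, complex.Im z != 0 -> F z = f z).
Proof.
move=> H; pose F z := if complex.Im z != 0 then f z else xget 0 [set l | nonreal_limit f z l].
have Ff z : complex.Im z != 0 -> F z = f z by rewrite /F => ->.
exists F; split => // z0 Uz0; have [L [d [d0 L0 HL]]] := H z0 Uz0.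
(* adding the estimates for (z, w) and (w, z) eliminates f and bounds the
   increments of k *)
have kL z w : normc (z - z0) < d -> normc (w - z0) < d -> complex.Im z != 0 ->
    complex.Im w != 0 -> normc (k z - k w) <= 2 * L * normc (z - w).
  move=> zd wd zi wi; have [->|zw] := eqVneq z w.
    by rewrite !subrr Normc.normc0 mulr0.
  have n0 : 0 < normc (z - w).
    rewrite lt_neqAle normc_ge0 andbT eq_sym; apply: contra_neq zw => /Normc.eq0_normc/eqP.
    by rewrite subr_eq0 => /eqP.
  have h1 := HL z w zd wd zi wi; have h2 := HL w z wd zd wi zi.
  rewrite -(ler_pM2l n0) -Normc.normcM.
  have -> : (z - w) * (k z - k w) =
     (f z - f w - (z - w) * k w) + (f w - f z - (w - z) * k z) by ring.
  apply: le_trans (ler_normcD _ _) _; rewrite (normcB w z) in h2.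
  by apply: le_trans (lerD h1 h2) _; rewrite expr2; lra.
have [w0 [w0i w0d]] := nonreal_near z0 d0.
pose B := normc (k w0) + 2 * L * (2 * d).
have dist z w : normc (z - z0) < d -> normc (w - z0) < d -> normc (z - w) <= 2 * d.
  by move=> zd wd; apply: le_trans (normc_tri z w z0) _; rewrite (normcB z0 w); lra.
have kB z : normc (z - z0) < d -> complex.Im z != 0 -> normc (k z) <= B.
  move=> zd zi; have := kL z w0 zd w0d zi w0i => h.
  have -> : k z = k w0 + (k z - k w0) by rewrite addrC subrK.
  apply: le_trans (ler_normcD _ _) _; rewrite lerD2l; apply: (le_trans h).
  by apply: ler_wpM2l; [exact: mulr_ge0|exact: dist].
have B0 : 0 <= B by apply: le_trans (kB w0 w0d w0i); exact: normc_ge0.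
pose C := B + L * (2 * d).
have C0 : 0 <= C by rewrite addr_ge0// !mulr_ge0// ltW.
have fL z w : normc (z - z0) < d -> normc (w - z0) < d -> complex.Im z != 0 ->
    complex.Im w != 0 -> normc (f z - f w) <= C * normc (z - w).
  move=> zd wd zi wi.
  have -> : f z - f w = (f z - f w - (z - w) * k w) + (z - w) * k w by rewrite subrK.
  apply: le_trans (ler_normcD _ _) _; rewrite Normc.normcM.
  have h1 := HL z w zd wd zi wi; have h2 := ler_wpM2l (normc_ge0 (z - w)) (kB w wd wi).
  have h3 := ler_wpM2l L0 (ler_wpM2l (normc_ge0 (z - w)) (dist z w zd wd)).
  by move: h1; rewrite expr2 /C; lra.
have [kap [Ck [dk [dk0 hkap]]]] : exists l, nonreal_limit k z0 l.
  apply: (@lipschitz_nonreal_limit k z0 (2 * L) d) => //; first exact: mulr_ge0.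
  by move=> w w' wi wi' wd wd'; exact: kL.
have Flim z : normc (z - z0) < d -> nonreal_limit f z (F z).
  move=> zd; have r0 : 0 < d - normc (z - z0) by rewrite subr_gt0.
  have sub w : normc (w - z) < d - normc (z - z0) -> normc (w - z0) < d.
    by move=> h; apply: le_lt_trans (normc_tri w z0 z) _; lra.
  rewrite /F; case: ifPn => zi.
    by exists C, (d - normc (z - z0)); split => // w wi wz; apply: fL => //; exact: sub.
  apply: (@xgetPex _ 0 [set l | nonreal_limit f z l]).
  apply: (@lipschitz_nonreal_limit f z C (d - normc (z - z0))) => // w w' wi wi' wd wd'.
  by apply: fL => //; exact: sub.
have z0d : normc (z0 - z0) < d by rewrite subrr Normc.normc0.
(* both end points of the Taylor estimate are moved to their limits, first the
   base point w to z0 and then the other one to an arbitrary z *)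
have T1 z : normc (z - z0) < d -> complex.Im z != 0 ->
    normc (f z - F z0 - (z - z0) * kap) <= L * normc (z - z0) ^+ 2.
  move=> zd zi; have [CF [dF [dF0 hF]]] := Flim z0 z0d.
  apply: (@le_near_nonreal z0 _ _ (L * (3 * d) + CF + (2 * d * Ck + normc kap))
    (Num.min d (Num.min dF dk))); first by rewrite !lt_min d0 dF0.
  move=> w wi; rewrite !lt_min => /andP[wd /andP[wdF wdk]].
  have -> : f z - F z0 - (z - z0) * kap = (f z - f w - (z - w) * k w) + (f w - F z0)
     + ((z - w) * (k w - kap) - (w - z0) * kap) by ring.
  have n0 := normc_ge0 (w - z0).
  have h1 := HL z w zd wd zi wi.
  have h2 := hF w wi wdF; have h3 := hkap w wi wdk.
  have h4 : normc (z - w) ^+ 2 <= normc (z - z0) ^+ 2 + 3 * d * normc (w - z0).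
    have := normc_tri z w z0; rewrite (normcB z0 w) => t.
    have := normc_ge0 (z - w); have := normc_ge0 (z - z0); nra.
  apply: le_trans (ler_normcD _ _) _; apply: le_trans (lerD (ler_normcD _ _) (ler_normcB _ _)) _.
  rewrite !Normc.normcM.
  have h5 := ler_pM (normc_ge0 _) (normc_ge0 _) (dist z w zd wd) h3.
  have h6 := ler_wpM2l L0 h4.
  lra.
apply: (@derivable_taylor F z0 kap L d) => // z zd.
have [CF [dF [dF0 hF]]] := Flim z zd.
have r0 : 0 < d - normc (z - z0) by rewrite subr_gt0.
apply: (@le_near_nonreal z _ _ (CF + L * (3 * d) + normc kap) (Num.min (d - normc (z - z0)) dF)).
  by rewrite lt_min r0.
move=> w wi; rewrite lt_min => /andP[wr wdF].
have wd : normc (w - z0) < d by apply: le_lt_trans (normc_tri w z0 z) _; lra.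
have -> : F z - F z0 - (z - z0) * kap = (f w - F z0 - (w - z0) * kap) - (f w - F z) + (w - z) * kap.
  by ring.
have h1 := T1 w wd wi; have h2 := hF w wi wdF.
have h4 : normc (w - z0) ^+ 2 <= normc (z - z0) ^+ 2 + 3 * d * normc (w - z).
  have := normc_tri w z0 z => t; have := normc_ge0 (w - z0); have := normc_ge0 (z - z0).
  have := normc_ge0 (w - z); nra.
apply: le_trans (ler_normcD _ _) _; apply: le_trans (lerD (ler_normcB _ _) (lexx _)) _.
rewrite Normc.normcM; have h6 := ler_wpM2l L0 h4; lra.
Qed.

End extension.

(** * Growth estimate on a half-line *)

Section bound.
Context {R : realType} (mu : set R -> R[i]) (M : R).
Hypothesis hmu : complex_radon_measure mu.
Hypothesis hmuM : forall alpha beta : R, beta - alpha <= 1 ->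
    (radon_variation mu `[alpha, beta] <= M%:E)%E.
Context (p : nat -> {sigma_finite_measure set R -> \bar R}).
Hypothesis hp : forall k, upper_variation (part mu k) = p k :> (set R -> \bar R).
Hypothesis hpM : forall k (a b : R), b - a <= 1 -> (p k `[a, b]%classic <= M%:E)%E.

Let M0 : 0 <= M := unit_bound_ge0 (hpM 0).

Lemma unit_fin (A : set R) a k : measurable A -> A `<=` `[a, a + 1] -> (p k A <= M%:E)%E.
Proof.
move=> mA Aa; apply: (@le_trans _ _ (p k `[a, a + 1]%classic)).
  by apply: le_measure => //; rewrite inE.
by apply: hpM; rewrite addrAC subrr add0r.
Qed.

Lemma unit_fineK (A : set R) a k : measurable A -> A `<=` `[a, a + 1] -> p k A \is a fin_num.
Proof. by move=> mA Aa; rewrite ge0_fin_numE// (le_lt_trans (unit_fin _ mA Aa)) ?ltry. Qed.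

(** In the first two terms of the decomposition of mu the components are differences
    of upper variations, by the Jordan decomposition. *)
Lemma jordan_unit (A : set R) a : measurable A -> A `<=` `[a, a + 1] ->
  mu A = \sum_(k < 4) 'i ^+ k * (fine (p k A))%:C.
Proof.
move=> mA Aa; have bA : bounded_borel A.
  by apply: (bounded_borel_sub mA Aa); exact: bounded_borel_itv.
have pk k : part mu k A = fine (p k A) - fine (p k.+2 A).
  have finA j : p j A \is a fin_num by exact: unit_fineK Aa.
  have := upper_variation_jordan (part_radon (k := k) hmu) bA.
  rewrite hp.
  have -> : upper_variation (fun B => - part mu k B) A = p k.+2 A.
    rewrite -hp; congr (upper_variation _ _); apply/funext => B.
    by rewrite /part !exprS mulrA mulrNN -expr2 sqr_i mulN1r mulNr ReN.
  by move=> ->; rewrite fineD//= addrK.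
rewrite part_sum !big_ord_recl !big_ord0 /= /bump /= !pk !expr0 !expr1 !mul1r.
by rewrite !exprS !expr0 !mulr1 !rmorphB /= -!expr2 sqr_i; ring.
Qed.

Section riemann.
Variables (A : set R) (a c e : R) (f : R -> R[i]) (n : nat) (F : nat -> set R) (v : nat -> R[i]).
Hypotheses (mA : measurable A) (Aa : A `<=` `[a, a + 1]) (mf : cmeasurable f).
Hypotheses (mF : forall i, measurable (F i)) (FA : forall i, F i `<=` A)
  (tF : trivIset setT F) (AF : forall t, A t -> exists2 i, (i < n)%N & F i t).
Hypotheses (fc : forall t, A t -> normc (f t) <= c)
  (fv : forall i t, F i t -> normc (f t - v i) <= e) (c0 : 0 <= c) (e0 : 0 <= e).

Let s t : R[i] := \sum_(i < n) v i * (\1_(F i) t)%:C.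

Let sE t : A t -> normc (f t - s t) <= e.
Proof.
move=> At; have [i ni Fit] := AF At.
have -> : s t = v i.
  rewrite /s (bigD1 (Ordinal ni))//= indicE mem_set// mulr1 big1 ?addr0// => j ji.
  rewrite indicE memNset ?mulr0// => Fjt; move/eqP: ji; apply; apply/val_inj => /=.
  by apply: tF => //; exists t.
exact: fv.
Qed.

Let finite_unit k (B : set R) : measurable B -> B `<=` A ->
  (p k).-integrable A (fun t => (\1_B t)%:E).
Proof.
move=> mB BA; apply/integrableP; split; first by apply/measurable_EFinP.
under eq_integral do rewrite gee0_abs ?lee_fin//.
rewrite integral_indic// setIidl//; apply: le_lt_trans (ltry M).
by apply: (unit_fin _ mB); exact: subset_trans Aa.
Qed.

Let ic i k : cintegrable (p k) A (fun t => (\1_(F i) t)%:C).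
Proof. by split => /=; [exact: finite_unit|exact: integrable0]. Qed.

Let ci i k : cintegral (p k) A (fun t => (\1_(F i) t)%:C) = (fine (p k (F i)))%:C.
Proof.
by rewrite /cintegral /= integral_indic// setIidl// integral0.
Qed.

Let icst k (r : R) : (p k).-integrable A (fun=> r%:E).
Proof.
apply/integrableP; split; first exact: measurable_cst.
rewrite integral_cst//=; apply: lte_mul_pinfty => //.
by rewrite (le_lt_trans (unit_fin _ mA Aa))// ltry.
Qed.

Let is_ k : cintegrable (p k) A s.
Proof.
apply: (cintegrable_sum mA n (F := fun i t => v i * (\1_(F i) t)%:C)) => i.
exact: (cintegrableZ mA (v i) (ic i k)).
Qed.

(** Integrals against mu are approximated by sums over a partition, and the values
    of mu on a partition add up to at most the variation. This gives the sharp
    constant c, which the decomposition into four positive measures would lose. *)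
Lemma riemann_bound : normc (radon_integral mu A f) <= (c + 9 * e) * M.
Proof.
have ms : cmeasurable s.
  split.
    rewrite /s; under eq_fun do rewrite Re_sum.
    apply: measurable_sum => i; apply: (cmeasurableZ _ _).1.
    exact: cmeasurable_real.
  rewrite /s; under eq_fun do rewrite Im_sum.
  apply: measurable_sum => i; apply: (cmeasurableZ _ _).2.
  exact: cmeasurable_real.
have mfs : cmeasurable (fun t => f t + (-1) * s t).
  by apply: cmeasurableD => //; exact: cmeasurableZ.
have ifs k : cintegrable (p k) A (fun t => f t + (-1) * s t).
  apply: (cintegrable_le mA mfs (icst k e)) => t At; rewrite mulN1r; exact: sE.
have split_int k : cintegral (p k) A f =
    cintegral (p k) A (fun t => f t + (-1) * s t) + \sum_(i < n) v i * (fine (p k (F i)))%:C.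
  have <- : cintegral (p k) A s = \sum_(i < n) v i * (fine (p k (F i)))%:C.
    rewrite (cintegral_sum mA n (F := fun i t => v i * (\1_(F i) t)%:C)); last first.
      by move=> i; exact: (cintegrableZ mA (v i) (ic i k)).
    by apply: eq_bigr => i _; rewrite (cintegralZ mA (v i) (ic i k)) ci.
  rewrite -(cintegralD mA (ifs k) (is_ k)); congr cintegral; apply/funext => t.
  by rewrite mulN1r subrK.
have small k : normc (cintegral (p k) A (fun t => f t + (-1) * s t)) <= 2 * e * M.
  have hs t : A t -> normc (f t + (-1) * s t) <= e by move=> At; rewrite mulN1r; exact: sE.
  apply: le_trans (normc_cintegral_le mA (ifs k) (icst k e) hs) _.
  rewrite -mulrA ler_wpM2l// Rintegral_cst// ler_wpM2l//.
  by rewrite -lee_fin fineK ?(unit_fin _ mA Aa)// (unit_fineK _ mA Aa).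
have E : radon_integral mu A f =
   \sum_(k < 4) 'i ^+ k * cintegral (p k) A (fun t => f t + (-1) * s t)
   + \sum_(i < n) v i * mu (F i).
  rewrite radon_integral_part.
  have -> : \sum_(i < n) v i * mu (F i) =
      \sum_(k < 4) 'i ^+ k * \sum_(i < n) v i * (fine (p k (F i)))%:C.
    under [RHS]eq_bigr do rewrite mulr_sumr.
    rewrite exchange_big /=; apply: eq_bigr => i _.
    rewrite (jordan_unit (mF i) (subset_trans (FA (i:=i)) Aa)) mulr_sumr.
    by apply: eq_bigr => k _; rewrite mulrCA.
  rewrite -big_split /=; apply: eq_bigr => k _.
  by rewrite hp split_int mulrDr.
rewrite E; apply: le_trans (ler_normcD _ _) _.
have -> : (c + 9 * e) * M = 4 * (2 * e * M) + (c + e) * M by ring.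
apply: lerD.
  apply: le_trans (ler_normc_sum _ _ _) _.
  apply: (@le_trans _ _ (\sum_(k < 4) 2 * e * M)); last first.
    by rewrite sumr_const card_ord -mulr_natl; lra.
  by apply: ler_sum => k _; rewrite Normc.normcM normcX normc_i expr1n mul1r.
apply: le_trans (ler_normc_sum _ _ _) _.
apply: (@le_trans _ _ ((c + e) * \sum_(i < n) normc (mu (F i)))).
  rewrite mulr_sumr; apply: ler_sum => i _; rewrite Normc.normcM.
  (* v i is only known to be small when F i contains a point *)
  have [F0|/set0P[t Ft]] := eqVneq (F i) set0.
    by rewrite F0 (complex_radon0 hmu) Normc.normc0 !mulr0.
  apply: ler_wpM2r; first exact: normc_ge0.
  have -> : v i = f t - (f t - v i) by rewrite subKr.
  by apply: le_trans (ler_normcB _ _) _; apply: lerD; [exact: fc (FA Ft)|exact: fv].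
apply: ler_wpM2l; first exact: addr_ge0.
rewrite -lee_fin.
apply: le_trans (hmuM (_ : (a + 1) - a <= 1)); last by rewrite addrAC subrr add0r.
apply: ereal_sup_ubound; exists n, F; split => //.
  move=> i; apply: (bounded_borel_sub (mF i) (subset_trans (FA (i:=i)) Aa)).
  exact: bounded_borel_itv.
by move=> i; apply: subset_trans (FA (i:=i)) Aa.
Qed.

End riemann.

(** Partition of a unit interval into N equal pieces, and N tends to infinity. *)
Lemma wave_piece_bound (A : set R) a z c : measurable A -> A `<=` `[a, a + 1] -> 0 <= c ->
  (forall t, A t -> normc (wave z t) <= c) ->
  normc (radon_integral mu A (wave z)) <= c * M.
Proof.
move=> mA Aa c0 hc; apply/ler_addgt0Pr => eps eps0.
pose Q := c * (3 * normc z * expR (normc z)).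
have Q0 : 0 <= Q by rewrite !mulr_ge0 ?normc_ge0 ?expR_ge0.
pose N := (Num.bound (9 * Q * M / eps)).+1.
have N0 : 0 < N%:R :> R by rewrite ltr0n.
have NM : 9 * (Q / N%:R) * M <= eps.
  have h : 9 * Q * M / eps <= N%:R.
    have q0 : 0 <= 9 * Q * M / eps.
      by apply: divr_ge0; [apply: mulr_ge0 => //; exact: mulr_ge0|exact: ltW].
    by apply: le_trans (ltW (archi_boundP q0)) _; rewrite ler_nat leqnSn.
  have -> : 9 * (Q / N%:R) * M = 9 * Q * M / N%:R by ring.
  by rewrite ler_pdivrMr//; move: h; rewrite ler_pdivrMr//; lra.
pose F (i : nat) : set R := A `&` `[a + i%:R / N%:R, a + i.+1%:R / N%:R[.
have FN i t : F i t -> i%:R <= (t - a) * N%:R < i.+1%:R.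
  move=> [_ /=]; rewrite in_itv /= -lerBrDl ler_pdivrMr// => /andP[-> h].
  by move: h; rewrite -ltrBlDl ltr_pdivlMr.
apply: (@le_trans _ _ ((c + 9 * (Q / N%:R)) * M)); last by rewrite mulrDl lerD2l.
apply: (@riemann_bound A a c (Q / N%:R) (wave z) N.+1 F (fun i => wave z (a + i%:R / N%:R))) => //.
- exact: cmeasurable_wave.
- by move=> i; apply: measurableI.
- by move=> i; exact: subIsetl.
- move=> i j _ _ [t [/FN/andP[i1 i2] /FN/andP[j1 j2]]].
  have := le_lt_trans i1 j2; have := le_lt_trans j1 i2; rewrite !ltr_nat !ltnS => h1 h2.
  by apply/eqP; rewrite eqn_leq h1 h2.
- move=> t At; have := Aa t At; rewrite /= in_itv /= => /andP[t1 t2].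
  have tN0 : 0 <= (t - a) * N%:R by rewrite mulr_ge0 ?subr_ge0.
  have /andP[i1 i2] := truncn_itv tN0.
  exists (Num.truncn ((t - a) * N%:R)).
    rewrite ltnS -(ler_nat R); apply: (le_trans i1).
    by rewrite ler_piMl// lerBlDl.
  split => //=; rewrite in_itv /= -lerBrDl ler_pdivrMr// i1 /=.
  by rewrite -ltrBlDl ltr_pdivlMr.
- move=> i t Ft; have At : A t := Ft.1; have /andP[i1 i2] := FN i t Ft.
  have -> : wave z (a + i%:R / N%:R) = wave z t * wave z (a + i%:R / N%:R - t).
    by rewrite -waveD; congr wave; ring.
  rewrite -{1}[wave z t]mulr1 -mulrBr Normc.normcM normcB /Q -mulrA.
  apply: ler_pM; rewrite ?normc_ge0 ?hc//.
  have dt : `|a + i%:R / N%:R - t| <= N%:R^-1.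
    rewrite ler_norml; apply/andP; split.
      rewrite -(ler_pM2r N0) mulNr mulVf ?gt_eqF// mulrBl mulrDl divfK ?gt_eqF//.
      by move: i2; rewrite -natr1; lra.
    rewrite -(ler_pM2r N0) mulVf ?gt_eqF// mulrBl mulrDl divfK ?gt_eqF//; lra.
  apply: le_trans (normc_waveB1_le dt (lexx (normc z))) _.
  have N1 : N%:R^-1 <= 1 :> R by rewrite invf_le1// ler1n.
  have -> : 3 * N%:R^-1 * normc z * expR (N%:R^-1 * normc z) =
     3 * normc z / N%:R * expR (N%:R^-1 * normc z) by ring.
  rewrite -[leRHS]mulrA [expR _ / _]mulrC mulrA; apply: ler_wpM2l.
    by rewrite !mulr_ge0 ?normc_ge0 ?invr_ge0.
  by rewrite ler_expR ler_piMl// normc_ge0.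
- by rewrite divr_ge0.
Qed.

Lemma radon_integralU (A B : set R) f : measurable A -> measurable B -> [disjoint A & B] ->
  (forall k, cintegrable (p k) (A `|` B) f) ->
  radon_integral mu (A `|` B) f = radon_integral mu A f + radon_integral mu B f.
Proof.
move=> mA mB AB hf; rewrite !radon_integral_part -big_split /=; apply: eq_bigr => k _.
rewrite hp -mulrDr; congr (_ * _); have [h1 h2] := hf k.
apply/eqP; rewrite eq_complex /=; apply/andP; split; apply/eqP.
  exact: (Rintegral_setU mA mB h1 AB).
exact: (Rintegral_setU mA mB h2 AB).
Qed.

(** Unit pieces of D contribute a geometric sum, and the tail is small because half
    of the exponential decay can be taken out of the integral. *)
Lemma half_line_bound (D : set R) z : complex.Im z != 0 -> measurable D ->
  (forall l : nat, exists a, D `&` [set x | l%:R <= `|x| < l.+1%:R] `<=` `[a, a + 1]) ->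
  (forall x, D x -> normc (wave z x) <= expR (- `|complex.Im z| * `|x|)) ->
  normc (radon_integral mu D (wave z)) <= M * (1 + `|complex.Im z|^-1).
Proof.
move=> z0 mD hD hw; set y := `|complex.Im z| in hw *.
have y0 : 0 < y by rewrite normr_gt0.
have y20 : 0 < y / 2 by rewrite divr_gt0.
have mS (b : R) : measurable [set x : R | `|x| < b].
  have -> : [set x : R | `|x| < b] = `]- b, b[%classic by apply/seteqP; split => x /=; rewrite in_itv /= ltr_norml.
  exact: measurable_itv.
(* D is exhausted by the bounded sets A n, each obtained from the previous one by
   adding a piece that lies in a unit interval *)
pose A (n : nat) := D `&` [set x : R | `|x| < n%:R].
have mA n : measurable (A n) by apply: measurableI.
have AS n : A n.+1 = A n `|` (D `&` [set x | n%:R <= `|x| < n.+1%:R]).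
  apply/seteqP; split => x.
    by move=> [Dx /= xn]; have [h|h] := ltP `|x| n%:R; [left|right]; split => //=; rewrite h xn.
  move=> [[Dx /= xn]|[Dx /= /andP[_ xn]]]; split => //=.
  by rewrite (lt_le_trans xn)// ler_nat.
have mP n : measurable (D `&` [set x | n%:R <= `|x| < n.+1%:R]).
  rewrite (_ : D `&` _ = A n.+1 `\` A n); first exact: measurableD.
  apply/seteqP; split => x.
    by move=> [Dx /= /andP[h1 h2]]; split; [split|move=> [_ /=]; rewrite ltNge h1].
  move=> [[Dx /= h1] h2]; split => //=; rewrite h1 andbT leNgt; apply/negP => h3.
  by apply: h2; split.
have iw k : cintegrable (p k) D (wave z).
  apply: (cintegrable_le mD (g := fun x => expR (- y * `|x - 0|))).
  - exact: cmeasurable_wave.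
  - apply: integrableS (exp_integrable (hpM k) 0 y0) => //.
  - by move=> x Dx; rewrite subr0; exact: hw.
have iwS k B : measurable B -> B `<=` D -> cintegrable (p k) B (wave z).
  by move=> mB BD; have [h1 h2] := iw k; split; apply: integrableS; [exact: mD| |exact: BD|exact: h1|exact: mD| |exact: BD|exact: h2].
have step n : normc (radon_integral mu (A n) (wave z)) <= M * \sum_(k < n) expR (- y * k%:R).
  elim: n => [|n IH].
    have -> : A 0%N = set0.
      by apply/seteqP; split => // x [_ /=]; rewrite ltNge normr_ge0.
    rewrite big_ord0 mulr0 radon_integral_part big1 ?Normc.normc0// => k _.
    by rewrite hp /cintegral !integral_set0 /= mulr0.
  rewrite AS radon_integralU//.
  - rewrite big_ord_recr mulrDr; apply: le_trans (ler_normcD _ _) _; apply: lerD => //.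
    have [a ha] := hD n; rewrite mulrC; apply: (wave_piece_bound (mP n) ha); first exact: expR_ge0.
    move=> t [Dt /= /andP[tn _]]; apply: le_trans (hw t Dt) _.
    by rewrite ler_expR ler_nM2l ?oppr_lt0.
  - apply/disj_setPS => x [[_ /= h1] [_ /= /andP[h2 _]]].
    by move: h1; rewrite ltNge h2.
  - by move=> k; rewrite -AS; apply: iwS => //; exact: subIsetl.
pose C := 16 * M * (1 + (y / 2)^-1).
have C0 : 0 <= C by rewrite !mulr_ge0// addr_ge0// invr_ge0 ltW.
have tail n : normc (radon_integral mu (D `\` A n) (wave z)) <= C * expR (- (y / 2) * n%:R).
  rewrite radon_integral_part; apply: le_trans (ler_normc_sum _ _ _) _.
  have mT : measurable (D `\` A n) by exact: measurableD.
  have TD : D `\` A n `<=` D by exact: subDsetl.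
  have hk (k : nat) : normc (cintegral (p k) (D `\` A n) (wave z)) <=
      2 * (expR (- (y / 2) * n%:R) * (2 * M * (1 + (y / 2)^-1))).
    have ie := exp_integrable (hpM k) 0 y20.
    have ie' : (p k).-integrable (D `\` A n) (fun x => (expR (- (y / 2) * `|x - 0|))%:E).
      exact: integrableS ie.
    have ig := integrableZl mT (expR (- (y / 2) * n%:R)) ie'.
    apply: le_trans (normc_cintegral_le mT (iwS k _ mT TD) (g := fun x => expR (- (y / 2) * n%:R) *
      expR (- (y / 2) * `|x - 0|)) ig _) _.
      move=> x [Dx xn]; apply: le_trans (hw x Dx) _; rewrite -expRD ler_expR subr0.
      have h : n%:R <= `|x| by rewrite leNgt; apply/negP => h; apply: xn.
      have := ler_wpM2l (ltW y20) h; lra.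
    rewrite ler_wpM2l// RintegralZl// ler_wpM2l ?expR_ge0//.
    rewrite -lee_fin fineK; last exact: integrable_fin_num.
    apply: le_trans (exp_integral_bound (hpM k) 0 y20).
    by apply: ge0_subset_integral => //; apply/measurable_EFinP; exact: measurable_expdist.
  apply: (@le_trans _ _ (\sum_(k < 4) 2 * (expR (- (y / 2) * n%:R) * (2 * M * (1 + (y / 2)^-1))))).
    apply: ler_sum => k _; rewrite Normc.normcM normcX normc_i expr1n mul1r hp; exact: hk.
  by rewrite sumr_const card_ord -mulr_natl /C; lra.
apply/ler_addgt0Pr => eps eps0.
pose n := Num.bound (C / eps * (2 / y)).
have hn : C * expR (- (y / 2) * n%:R) <= eps.
  have h : C / eps * (2 / y) <= n%:R.
    apply/ltW/archi_boundP; apply: mulr_ge0; first by apply: divr_ge0 => //; exact: ltW.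
    by apply: divr_ge0 => //; exact: ltW.
  have := expR_ge1Dx (y / 2 * n%:R); rewrite mulNr expRN => h2.
  rewrite ler_pdivrMr ?expR_gt0// mulrC -ler_pdivrMr//; apply: le_trans h2.
  have := ler_wpM2l (ltW y20) h.
  have -> : y / 2 * (C / eps * (2 / y)) = C / eps by field; rewrite !gt_eqF.
  lra.
have AD : A n `<=` D by exact: subIsetl.
have -> : D = A n `|` (D `\` A n) by rewrite setDUK.
rewrite radon_integralU//.
- apply: le_trans (ler_normcD _ _) _; apply: lerD; last exact: le_trans (tail n) hn.
  apply: (le_trans (step n)); apply: ler_wpM2l => //; exact: geo_sum_le.
- exact: measurableD.
- by apply/disj_setPS; rewrite setDIK.
- by move=> k; rewrite setDUK.
Qed.

End bound.

(** * The Carleman transform *)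

Section halving.
Context {R : realType} (q q' : {measure set R -> \bar R}).
Hypothesis q'E : forall A : set R, measurable A -> ~ A 0 -> q' A = q A.
Hypothesis q'0 : q' [set 0] = ((2^-1)%:E * q [set 0%R])%E.

(** The halved atom, moved from the measure to the integrand. *)
Definition half_weight (D : set R) (x : R) : R :=
  if x == 0 then 2^-1 else \1_D x.

Lemma half_integral (D : set R) (f : R -> R) : measurable D -> D 0 ->
  measurable_fun setT f ->
  Rintegral q' D f = Rintegral q setT (fun x => half_weight D x * f x).
Proof.
move=> mD D0 mf; congr fine.
have mD0 : measurable (D `\ 0) by exact: measurableD.
have m1 : measurable [set 0 : R] by exact: measurable_set1.
have sD : [set 0] `<=` D by move=> _ ->.
have DE : [set 0] `|` (D `\ 0) = D by rewrite setDUK.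
have dis : [disjoint [set 0 : R] & D `\ 0]%classic by apply/disj_setPS; rewrite setDIK.
have mw : measurable_fun setT (fun x => half_weight D x * f x).
  apply: measurable_funM => //; apply: measurable_fun_ifT => //.
  by apply: measurable_fun_eqr.
have -> : (\int[q]_x (half_weight D x * f x)%:E = \int[q]_(x in D) (half_weight D x * f x)%:E)%E.
  rewrite [RHS]integral_mkcond; apply: eq_integral => x _; rewrite patchE.
  case: ifPn => // /negP xD; rewrite /half_weight; case: eqP => [x0|_].
    by exfalso; apply: xD; rewrite x0 inE.
  by rewrite indicE memNset ?mul0r// => Dx; apply: xD; rewrite inE.
have split_at0 (m : {measure set R -> \bar R}) (g : R -> R) : measurable_fun setT g ->
    (\int[m]_(x in D) (g x)%:E =
     \int[m]_(x in [set 0%R]) (g x)%:E + \int[m]_(x in D `\ 0%R) (g x)%:E)%E.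
  move=> mg; rewrite -[in LHS]DE integral_setU//.
  by apply/measurable_EFinP; apply: measurable_funTS.
rewrite !split_at0//; congr (_ + _)%E.
  transitivity (\int[q']_(x in [set 0%R]) cst (f 0%R)%:E x)%E.
    by apply: eq_integral => x; rewrite inE => ->.
  transitivity (\int[q]_(x in [set 0%R]) cst (2^-1 * f 0)%:E x)%E.
    by rewrite !integral_cst// q'0 EFinM muleA [((f 0)%:E * _)%E]muleC.
  by apply: eq_integral => x; rewrite inE => ->; rewrite /half_weight eqxx.
rewrite (eq_measure_integral q); last first.
  by move=> A mA AD; apply: q'E => // /AD [_]; apply.
apply: eq_integral => x; rewrite inE => -[Dx x0].
rewrite /half_weight; case: eqP => [//|_].
by rewrite indicE mem_set ?mul1r.
Qed.

Lemma half_cintegral (D : set R) (f : R -> R[i]) : measurable D -> D 0 -> cmeasurable f ->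
  cintegral q' D f = cintegral q setT (fun x => (half_weight D x)%:C * f x).
Proof.
move=> mD D0 [f1 f2]; apply/eqP; rewrite eq_complex /=; apply/andP; split; apply/eqP.
  rewrite -[LHS]/(Rintegral q' D _) half_integral//; congr fine.
  by apply: eq_integral => x _; rewrite ReM /= mul0r subr0.
rewrite -[LHS]/(Rintegral q' D _) half_integral//; congr fine.
by apply: eq_integral => x _; rewrite ImM /= mul0r addr0.
Qed.

End halving.

Section carleman.
Context {R : realType} (mu : set R -> R[i]) (M : R).
Hypothesis hmu : complex_radon_measure mu.
Hypothesis hmuM : forall alpha beta : R, beta - alpha <= 1 ->
    (radon_variation mu `[alpha, beta] <= M%:E)%E.

Lemma halve_at0_integral (D : set R) (f : R -> R[i]) : measurable D -> D 0 -> cmeasurable f ->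
  radon_integral (halve_at0 mu) D f =
  radon_integral mu setT (fun x => (half_weight D x)%:C * f x).
Proof.
move=> mD D0 mf.
have hmu' := halve_at0_radon hmu.
have [p [hp _]] := jordan_measures hmu hmuM.
have [p' [hp' _]] := jordan_measures hmu'
  (fun a b ab => le_trans (halve_at0_variation _ hmu) (hmuM ab)).
rewrite !radon_integral_part; apply: eq_bigr => k _; rewrite hp hp'; congr (_ * _).
apply: half_cintegral => // [A mA A0|].
  by have := upper_variation_halve k hmu A0; rewrite hp hp'.
by have := upper_variation_halve0 k hmu; rewrite hp hp'.
Qed.

Lemma carleman_plusE z : 0 < complex.Im z -> carleman_plus mu z = correlation mu (ckernel z) 0.
Proof.
move=> z0; rewrite /carleman_plus.
have -> : (fun t => cexp ('i * t%:C * z)) = wave z by [].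
rewrite halve_at0_integral//; [|by rewrite /= in_itv /= lexx|exact: cmeasurable_wave].
rewrite /correlation; congr radon_integral; apply/funext => x.
rewrite subr0 /ckernel z0 mulrC; congr (_ * _%:C).
rewrite /half_weight /heaviside indicE; have [x0|x0|x0] := ltgtP x 0.
- by rewrite memNset//= in_itv /= andbT leNgt x0.
- by rewrite mem_set//= in_itv /= ltW.
- by [].
Qed.

(** The sign in front of the integral over the negative half-line is the one that
    turns the half weight into the Heaviside function minus 1. *)
Lemma carleman_minusE z : complex.Im z < 0 -> carleman_minus mu z = correlation mu (ckernel z) 0.
Proof.
move=> z0; rewrite /carleman_minus.
have -> : (fun t => cexp ('i * t%:C * z)) = wave z by [].
rewrite halve_at0_integral//; [|by rewrite /= in_itv /= lexx|exact: cmeasurable_wave].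
have [p [hp hpM]] := jordan_measures hmu hmuM.
rewrite /correlation -mulN1r !radon_integral_part mulr_sumr; apply: eq_bigr => k _.
rewrite mulrCA; congr (_ * _); rewrite hp.
have E x : ckernel z (x - 0) = (-1) * ((half_weight `]-oo, 0%R] x)%:C * wave z x).
  rewrite subr0 /ckernel (lt_gtF z0) mulrA [_ * wave z x]mulrC; congr (_ * _).
  rewrite mulN1r -rmorphN; congr (_%:C).
  rewrite /half_weight /heaviside indicE; have [x0|x0|x0] := ltgtP x 0.
  - by rewrite mem_set//= ?in_itv /= ?sub0r// ltW.
  - by rewrite memNset//= ?in_itv /= ?subrr ?oppr0// leNgt x0.
  - by field.
rewrite (funext E) cintegralZ//.
have kz : exp_decay (ckernel z) by apply: exp_decay_ckernel; rewrite lt_eqF.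
have := cintegrableZ measurableT (-1) (exp_decay_integrable (hpM k) 0 kz).
by under eq_fun do rewrite E mulrA mulrNN !mul1r.
Qed.

End carleman.

Local Close Scope complex_scope.

Theorem theorem5p1 (R : realType) (M : R) (mu : set R -> R[i])
  (K : R -> R[i]) (a b : \bar R)
  (hM : 0 < M)
  (hmu : complex_radon_measure mu)
  (hmuM : forall alpha beta : R, beta - alpha <= 1 ->
    (radon_variation mu `[alpha, beta] <= M%:E)%E)
  (hK : cintegrable lebesgue_measure [set: R] K)
  (hab : (a < b)%E)
  (hKhat : forall lambda : R, (a < lambda%:E < b)%E -> fourier K lambda != 0)
  (hint : forall u : R,
    cintegrable (radon_variation mu) [set: R] (fun t => K (t - u)))
  (hzero : forall u : R,
    radon_integral mu [set: R] (fun t => K (t - u)) = 0) :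
  (forall z : R[i], complex.Im z != 0 ->
    Normc.normc (carleman mu z) <= M * (1 + `|complex.Im z|^-1)) /\
  continues_across a b (carleman_plus mu) (carleman_minus mu).
Proof.
have hmu' := halve_at0_radon hmu.
have hmuM' (alpha beta : R) : beta - alpha <= 1 ->
    (radon_variation (halve_at0 mu) `[alpha, beta] <= M%:E)%E.
  by move=> ab; exact: le_trans (halve_at0_variation _ hmu) (hmuM _ _ ab).
have [p [hp hpM]] := jordan_measures hmu hmuM.
have [p' [hp' hpM']] := jordan_measures hmu' hmuM'.
split.
  move=> z z0; rewrite /carleman; case: ifPn => [y0|].
    apply: (half_line_bound hmu' hmuM' hp' hpM' z0) => // [l|x].
      exists l%:R => x [/=]; rewrite !in_itv /= andbT => x0.
      rewrite (ger0_norm x0) => /andP[-> h] /=.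
      by rewrite natr1 ltW.
    move=> Dx; have x0 : 0 <= x by move: Dx; rewrite /= in_itv /= andbT.
    by rewrite normc_wave (ger0_norm x0) (gtr0_norm y0) mulNr mulrC.
  rewrite -leNgt => y0; have {}y0 : complex.Im z < 0 by rewrite lt_neqAle z0.
  rewrite /carleman_minus normcN.
  apply: (half_line_bound hmu' hmuM' hp' hpM' z0) => // [l|x].
    exists (- l.+1%:R) => x [/=]; rewrite !in_itv /= => x0.
    by rewrite (ler0_norm x0) -natr1 => /andP[h1 h2]; apply/andP; split; lra.
  move=> Dx; have x0 : x <= 0 by move: Dx; rewrite /= in_itv.
  by rewrite normc_wave (ler0_norm x0) (ltr0_norm y0) opprK mulrN mulrC.
have [L hL] := @lebesgue_sigma_finite_measure R.
have Lr (c : R) (A : set R) : measurable A -> L ((fun x => c - x) @^-1` A) = L A.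
  by rewrite hL; exact: lebesgue_reflection.
have LK : cintegrable L setT K by rewrite hL.
have var0 : radon_variation mu set0 = 0%E.
  apply/eqP; rewrite eq_le; apply/andP; split.
    apply: ge_ereal_sup => _ [n [F [_ _ F0 ->]]]; rewrite big1// => i _.
    have -> : F i = set0 by rewrite -subset0; exact: F0.
    by rewrite (complex_radon0 hmu) Normc.normc0.
  apply: le_trans (normc_le_variation (complex_radon0 hmu) bounded_borel0 (@subset_refl _ _)).
  by rewrite lee_fin normc_ge0.
have pK k u : cintegrable (p k) setT (fun t => K (t - u)).
  have pv A : (p k A <= radon_variation mu A)%E.
    by rewrite -hp; exact: part_le_variation.
  by have [h1 h2] := hint u; split; exact: integrable_set_fun var0 pv _ _ measurableT _.
have contr z : slit_plane a b z -> contracting mu z.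
  move=> [[zu|zl]|[x xab <-]].
  - by apply: (contracting_nonreal hp hpM); rewrite gt_eqF.
  - by apply: (contracting_nonreal hp hpM); rewrite lt_eqF.
  - apply: (contracting_fourier hp hpM Lr LK pK hzero).
    by rewrite hL; exact: hKhat.
have [F [F1 F2]] := @taylor_extension R (fun z => correlation mu (ckernel z) 0)
  (fun z => correlation mu (ckernel_deriv z) 0) (slit_plane a b)
  (fun z Uz => correlation_taylor hp hpM (contr z Uz)).
exists F; split.
- exact: F1.
- move=> z; rewrite inE => zu; rewrite F2 ?gt_eqF//.
  by rewrite (carleman_plusE hmu hmuM zu).
- move=> z; rewrite inE => zl; rewrite F2 ?lt_eqF//.
  by rewrite (carleman_minusE hmu hmuM zl).
Qed.
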